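(* Let $k$ be a field. The PROP $\mathtt{FinRel}_k$ is presented by the generators $s_c\colon 1\to 1$ (one for each $c\in k$), $\mu\colon 2\to 1$, $\zeta\colon 0\to 1$, $\Delta\colon 1\to 2$, $!\colon 1\to 0$, $\cup\colon 2\to 0$, $\cap\colon 0\to 2$ and the following equations (for all $b,c\in k$, with $1$ the identity on the object $1$, $1_0$ the identity on the object $0$, $B\colon 2\to2$ the braiding, and $\oplus$ the tensor product of morphisms): (1) $\mu\circ(\zeta\oplus 1)=1$; (2) $\mu\circ(1\oplus\mu)=\mu\circ(\mu\oplus 1)$; (3) $\mu\circ B=\mu$; (4) $(!\oplus 1)\circ\Delta=1$; (5) $(1\oplus\Delta)\circ\Delta=(\Delta\oplus 1)\circ\Delta$; (6) $B\circ\Delta=\Delta$; (7) $\Delta\circ\mu=(\mu\oplus\mu)\circ(1\oplus B\oplus 1)\circ(\Delta\oplus\Delta)$; (8) $\Delta\circ\zeta=\zeta\oplus\zeta$; (9) $!\circ\mu={!}\oplus{!}$; (10) $!\circ\zeta=1_0$; (11) $s_{bc}=s_b\circ s_c$; (12) $s_{b+c}=\mu\circ(s_b\oplus s_c)\circ\Delta$; (13) $s_1=1$; (14) $s_0=\zeta\circ{!}$; (15) $\mu\circ(s_c\oplus s_c)=s_c\circ\mu$; (16) $s_c\circ\zeta=\zeta$; (17) $(s_c\oplus s_c)\circ\Delta=\Delta\circ s_c$; (18) $!\circ s_c={!}$; (19)--(20) $(\cup\oplus1)\circ(1\oplus\cap)=1=(1\oplus\cup)\circ(\cap\oplus1)$;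 (21)--(22) $(\mu\oplus1)\circ(1\oplus\mu^\dagger)=\mu^\dagger\circ\mu=(1\oplus\mu)\circ(\mu^\dagger\oplus1)$; (23)--(24) $(\Delta^\dagger\oplus1)\circ(1\oplus\Delta)=\Delta\circ\Delta^\dagger=(1\oplus\Delta^\dagger)\circ(\Delta\oplus1)$; (25) $\mu\circ\mu^\dagger=1$; (26) $\zeta^\dagger\circ\zeta=1_0$; (27) $\Delta^\dagger\circ\Delta=1$; (28) $!\circ{!}^\dagger=1_0$; (29) $\cup\circ(s_{-1}\oplus1)=\zeta^\dagger\circ\mu$; (30) $\cap=\Delta\circ{!}^\dagger$; (31) $s_c^\dagger=s_{c^{-1}}$ for $c\neq0$. Here the adjoints are the following abbreviations: $\mu^\dagger=(1\oplus1\oplus\cup)\circ(1\oplus1\oplus\mu\oplus1)\circ\big(((1\oplus\cap\oplus1)\circ\cap)\oplus1\big)$, $\zeta^\dagger=\cup\circ(\zeta\oplus1)$, $\Delta^\dagger=\big((\cup\circ(1\oplus\cup\oplus1))\oplus1\big)\circ(1\oplus1\oplus\Delta\oplus1)\circ(1\oplus1\oplus\cap)$, $!^\dagger=(!\oplus1)\circ\cap$, $s_c^\dagger=(\cup\oplus1)\circ(1\oplus s_c\oplus1)\circ(1\oplus\cap)$. That is, the PROP morphism from the free PROP on these generators to $\mathtt{FinRel}_k$ which interprets the generators as the linear relations $s_c=\{(x,cx)\}$, $\mu=\{(x,y,x+y)\}$, $\zeta=\{(0,0)\}\subseteq\{0\}\oplus k$, $\Delta=\{(x,x,x)\}\subseteq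 k\oplus k^2$, $!=\{(x,0)\}\subseteq k\oplus\{0\}$, $\cup=\{(x,x,0)\}\subseteq k^2\oplus\{0\}$, $\cap=\{(0,x,x)\}\subseteq\{0\}\oplus k^2$ (with $x,y$ ranging over $k$) exhibits $\mathtt{FinRel}_k$ as the PROP presented by these generators and equations.
   Context: A PROP is a strict symmetric monoidal category whose objects are the natural numbers, with monoidal product of objects given by addition. A PROP morphism is a strict symmetric monoidal functor sending the object $1$ to the object $1$. A linear relation from a vector space $U$ to a vector space $V$ is a linear subspace $L\subseteq U\oplus V$. Linear relations $L\subseteq U\oplus V$ and $L'\subseteq V\oplus W$ compose as $L'L=\{(u,w):\exists v\in V,\ (u,v)\in L,\ (v,w)\in L'\}$. The direct sum of $L\subseteq U\oplus V$ and $L'\subseteq U'\oplus V'$ is $\{(u,u',v,v'):(u,v)\in L,(u',v')\in L'\}$. $\mathtt{FinRel}_k$ is the PROP whose morphisms $m\to n$ are the linear relations from $k^m$ to $k^n$, with this composition and with direct sum as tensor product; the braiding is the graph of $(x,y)\mapsto(y,x)$. A signature $\Sigma$ is a set of formal symbols $\sigma\colon m\to n$ ($m,n\in\mathbb N$). $\Sigma$-terms are built inductively from $\mathrm{id}\colon1\to1$, the braiding $2\to 2$ and the symbols of $\Sigma$ by composition and monoidal product; an equation is a pair of $\Sigma$-terms of the same type. $\mathtt F\Sigma$ is the free PROP on $\Sigma$. Given a set $E$ of equations, let $\mathcal E$ be the signature with one symbol for each equation in $E$, of the same type, and let $\lambda,\rho\colon\mathtt F\mathcal E\to\mathtt F\Sigma$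 be the PROP morphisms sending each such symbol to the left-hand, respectively right-hand, side of the equation. The PROP presented by $(\Sigma,E)$ is the coequalizer of $\lambda,\rho$ in the category of PROPs. $g\circ f$ means first $f$, then $g$. *)

(* Defs.v *)
From HB Require Import structures.
From mathcomp Require Import all_boot all_order all_algebra boolp.

Set Implicit Arguments.
Unset Strict Implicit.
Unset Printing Implicit Defensive.

(* Strict associativity and unitality of the tensor product only hold up to
   transport along equalities of natural numbers such as [addnA].  All proofs
   of such an equality are equal, so the choice of proof does not matter. *)
Definition hcast (H : nat -> nat -> Type) m m' n n'
    (em : m = m') (en : n = n') (f : H m n) : H m' n' :=
  let: erefl := em in let: erefl := en in f.
Arguments hcast : simpl never.

(* The axioms of a strict symmetric monoidal category on the objects [nat],
   with [+] as tensor product of objects, up to a family [R] of relations: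
   equality in the definition of a PROP, a congruence of terms in the
   construction of free PROPs.  [comp g f] is first [f], then [g]. *)
Record PROP_laws (H : nat -> nat -> Type)
    (R : forall m n, H m n -> H m n -> Prop)
    (id : forall n, H n n)
    (comp : forall m n p, H n p -> H m n -> H m p)
    (tens : forall m n m' n', H m n -> H m' n' -> H (m + m') (n + n'))
    (braid : forall m n, H (m + n) (n + m)) : Prop := {
  law_compA : forall m n p q (h : H p q) (g : H n p) (f : H m n),
    R _ _ (comp _ _ _ h (comp _ _ _ g f)) (comp _ _ _ (comp _ _ _ h g) f);
  law_comp1m : forall m n (f : H m n), R _ _ (comp _ _ _ (id n) f) f;
  law_compm1 : forall m n (f : H m n), R _ _ (comp _ _ _ f (id m)) f;
  law_tens1 : forall m n, R _ _ (tens _ _ _ _ (id m) (id n)) (id (m + n));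
  law_tens_comp : forall m n p m' n' p'
      (g : H n p) (f : H m n) (g' : H n' p') (f' : H m' n'),
    R _ _ (tens _ _ _ _ (comp _ _ _ g f) (comp _ _ _ g' f'))
          (comp _ _ _ (tens _ _ _ _ g g') (tens _ _ _ _ f f'));
  law_tensA : forall m n m' n' m'' n''
      (f : H m n) (g : H m' n') (h : H m'' n''),
    R _ _ (hcast (addnA m m' m'') (addnA n n' n'')
             (tens _ _ _ _ f (tens _ _ _ _ g h)))
          (tens _ _ _ _ (tens _ _ _ _ f g) h);
  law_tens0m : forall m n (f : H m n),
    R _ _ (hcast (add0n m) (add0n n) (tens _ _ _ _ (id 0) f)) f;
  law_tensm0 : forall m n (f : H m n),
    R _ _ (hcast (addn0 m) (addn0 n) (tens _ _ _ _ f (id 0))) f;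
  law_braid_nat : forall m n m' n' (f : H m n) (g : H m' n'),
    R _ _ (comp _ _ _ (braid n n') (tens _ _ _ _ f g))
          (comp _ _ _ (tens _ _ _ _ g f) (braid m m'));
  law_braidK : forall m n,
    R _ _ (comp _ _ _ (braid n m) (braid m n)) (id (m + n));
  law_braidD : forall m n p,
    R _ _ (braid m (n + p))
      (hcast (esym (addnA m n p)) (addnA n p m)
        (comp _ _ _ (tens _ _ _ _ (id n) (braid m p))
          (hcast (erefl _) (esym (addnA n m p))
            (tens _ _ _ _ (braid m n) (id p)))));
  law_Dbraid : forall m n p,
    R _ _ (braid (m + n) p)
      (hcast (addnA m n p) (esym (addnA p m n))
        (comp _ _ _ (tens _ _ _ _ (braid m p) (id n))
          (hcast (erefl _) (addnA m p n)
            (tens _ _ _ _ (id m) (braid n p)))))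
}.

Record PROP := MkPROP {
  hom : nat -> nat -> Type;
  pid : forall n, hom n n;
  pcomp : forall m n p, hom n p -> hom m n -> hom m p;
  ptens : forall m n m' n', hom m n -> hom m' n' -> hom (m + m') (n + n');
  pbraid : forall m n, hom (m + n) (n + m);
  PROP_ax : PROP_laws (fun m n => @eq (hom m n)) pid pcomp ptens pbraid
}.

Arguments hom : clear implicits.
Arguments pid : clear implicits.
Arguments pbraid : clear implicits.

(* A strict monoidal functor between PROPs sending 1 to 1 sends
   n = 1 + ... + 1 to n, so it is determined by its action on morphisms. *)
Record PROP_morphism (A B : PROP) := MkPROP_morphism {
  pmap : forall m n, hom A m n -> hom B m n;
  pmap_id : forall n, pmap (pid A n) = pid B n;
  pmap_comp : forall m n p (g : hom A n p) (f : hom A m n),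
    pmap (pcomp g f) = pcomp (pmap g) (pmap f);
  pmap_tens : forall m n m' n' (f : hom A m n) (g : hom A m' n'),
    pmap (ptens f g) = ptens (pmap f) (pmap g);
  pmap_braid : forall m n, pmap (pbraid A m n) = pbraid B m n
}.

Definition morph_eq (A B : PROP) (F G : PROP_morphism A B) : Prop :=
  forall m n (f : hom A m n), pmap F f = pmap G f.

Section MorphComp.
Variables (A B C : PROP) (G : PROP_morphism B C) (F : PROP_morphism A B).

Definition morph_comp : PROP_morphism A C.
Proof.
exists (fun m n (f : hom A m n) => pmap G (pmap F f)).
- by move=> n; rewrite !pmap_id.
- by move=> *; rewrite !pmap_comp.
- by move=> *; rewrite !pmap_tens.
- by move=> *; rewrite !pmap_braid.
Defined.
End MorphComp.

Definition is_coequalizer (A B C : PROP) (l r : PROP_morphism A B)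
    (q : PROP_morphism B C) : Prop :=
  morph_eq (morph_comp q l) (morph_comp q r) /\
  forall (D : PROP) (h : PROP_morphism B D),
    morph_eq (morph_comp h l) (morph_comp h r) ->
    exists u : PROP_morphism C D,
      morph_eq (morph_comp u q) h /\
      forall u' : PROP_morphism C D,
        morph_eq (morph_comp u' q) h -> morph_eq u' u.

(* [S m n] is the set of symbols of type m -> n. *)
Definition signature := nat -> nat -> Type.

(* [tid0] is the empty monoidal product. *)
Inductive term (S : signature) : nat -> nat -> Type :=
| tid0 : term S 0 0
| tid1 : term S 1 1
| tswap : term S 2 2
| tgen m n : S m n -> term S m n
| tcomp m n p : term S n p -> term S m n -> term S m p
| ttens m n m' n' : term S m n -> term S m' n' -> term S (m + m') (n + n').

Arguments tid0 {S}.
Arguments tid1 {S}.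
Arguments tswap {S}.

Declare Scope diagram_scope.
Delimit Scope diagram_scope with diag.
Bind Scope diagram_scope with term.
Notation "g ∘ f" := (tcomp g f)
  (at level 40, left associativity) : diagram_scope.
Notation "f ⊕ g" := (ttens f g)
  (at level 38, left associativity) : diagram_scope.

Section FreePROP.
Variable S : signature.
Local Notation T := (term S).
Local Open Scope diagram_scope.

Fixpoint tid (n : nat) : T n n :=
  if n is n'.+1 then tid1 ⊕ tid n' else tid0.

(* The braiding of 1 with n, then of m with n, by the hexagon identities. *)
Fixpoint tbraid1 (n : nat) : T (1 + n) (n + 1) :=
  match n return T (1 + n) (n + 1) with
  | 0 => tid1
  | n'.+1 => @tcomp S (2 + n') (2 + n') (1 + (n' + 1))
               (tid1 ⊕ tbraid1 n') (tswap ⊕ tid n')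
  end.

Fixpoint tbraid (m n : nat) : T (m + n) (n + m) :=
  match m return T (m + n) (n + m) with
  | 0 => hcast (erefl n) (esym (addn0 n)) (tid n)
  | m'.+1 => hcast (addnA 1 m' n) (esym (addnA n 1 m'))
               ((tbraid1 n ⊕ tid m')
                  ∘ hcast (erefl _) (addnA 1 n m') (tid1 ⊕ tbraid m' n))
  end.

Record is_congruence (R : forall m n, T m n -> T m n -> Prop) : Prop := {
  cong_refl : forall m n (t : T m n), R _ _ t t;
  cong_sym : forall m n (s t : T m n), R _ _ s t -> R _ _ t s;
  cong_trans : forall m n (s t u : T m n),
    R _ _ s t -> R _ _ t u -> R _ _ s u;
  cong_comp : forall m n p (g g' : T n p) (f f' : T m n),
    R _ _ g g' -> R _ _ f f' -> R _ _ (g ∘ f) (g' ∘ f');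
  cong_tens : forall m n m' n' (f f' : T m n) (g g' : T m' n'),
    R _ _ f f' -> R _ _ g g' -> R _ _ (f ⊕ g) (f' ⊕ g')
}.

(* The smallest congruence modulo which terms form a PROP. *)
Definition teq m n (s t : T m n) : Prop :=
  forall R : (forall m n, T m n -> T m n -> Prop), is_congruence R ->
    PROP_laws R tid (@tcomp S) (@ttens S) tbraid -> R m n s t.

Lemma teq_congruence : is_congruence teq.
Proof.
split.
- by move=> m n t R cR _; apply: cong_refl.
- by move=> m n s t st R cR lR; apply: (cong_sym cR); apply: st.
- move=> m n s t u st tu R cR lR.
  by apply: (cong_trans cR) (st R cR lR) (tu R cR lR).
- move=> m n p g g' f f' gg ff R cR lR.
  by apply: (cong_comp cR); [apply: gg | apply: ff].
- move=> m n m' n' f f' g g' ff gg R cR lR.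
  by apply: (cong_tens cR); [apply: ff | apply: gg].
Qed.

Lemma teq_laws : PROP_laws teq tid (@tcomp S) (@ttens S) tbraid.
Proof.
split; intros; intros R cR lR.
- exact: (law_compA lR).
- exact: (law_comp1m lR).
- exact: (law_compm1 lR).
- exact: (law_tens1 lR).
- exact: (law_tens_comp lR).
- exact: (law_tensA lR).
- exact: (law_tens0m lR).
- exact: (law_tensm0 lR).
- exact: (law_braid_nat lR).
- exact: (law_braidK lR).
- exact: (law_braidD lR).
- exact: (law_Dbraid lR).
Qed.

HB.instance Definition _ m n := gen_eqMixin (T m n).
HB.instance Definition _ m n := gen_choiceMixin (T m n).

Definition teqb m n : rel (T m n) := fun s t => `[< teq s t >].

Lemma teqb_refl m n : reflexive (@teqb m n).
Proof. by move=> t; apply/asboolP; apply: (cong_refl teq_congruence). Qed.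

Lemma teqb_sym m n : symmetric (@teqb m n).
Proof.
by move=> s t; apply/asboolP/asboolP; apply: (cong_sym teq_congruence).
Qed.

Lemma teqb_trans m n : transitive (@teqb m n).
Proof.
move=> t s u /asboolP st /asboolP tu; apply/asboolP.
exact: (cong_trans teq_congruence st tu).
Qed.

Canonical teqb_equiv m n :=
  EquivRel (@teqb m n) (@teqb_refl m n) (@teqb_sym m n) (@teqb_trans m n).

Local Open Scope quotient_scope.

Definition free_hom (m n : nat) : Type := {eq_quot teqb_equiv m n}.

Definition tclass m n (t : T m n) : free_hom m n := \pi_({eq_quot _}) t.
Definition trepr m n (f : free_hom m n) : T m n :=
  repr (f : {eq_quot teqb_equiv m n}).

Lemma treprK m n (f : free_hom m n) : tclass (trepr f) = f.
Proof. exact: reprK. Qed.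

Lemma tclassP m n (s t : T m n) : tclass s = tclass t <-> teq s t.
Proof.
split=> [/eqmodP /asboolP // | st].
by apply/eqmodP; apply/asboolP.
Qed.

Lemma tclassK m n (t : T m n) : teq (trepr (tclass t)) t.
Proof. by apply/tclassP; rewrite treprK. Qed.

Definition free_comp m n p (g : free_hom n p) (f : free_hom m n) :
  free_hom m p := tclass (trepr g ∘ trepr f).
Definition free_tens m n m' n' (f : free_hom m n) (g : free_hom m' n') :
  free_hom (m + m') (n + n') := tclass (trepr f ⊕ trepr g).

Lemma free_compE m n p (g : T n p) (f : T m n) :
  free_comp (tclass g) (tclass f) = tclass (g ∘ f).
Proof. by apply/tclassP; apply: (cong_comp teq_congruence); apply: tclassK. Qed.

Lemma free_tensE m n m' n' (f : T m n) (g : T m' n') :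
  free_tens (tclass f) (tclass g) = tclass (f ⊕ g).
Proof. by apply/tclassP; apply: (cong_tens teq_congruence); apply: tclassK. Qed.

Lemma free_hcast m m' n n' (em : m = m') (en : n = n') (t : T m n) :
  hcast (H := free_hom) em en (tclass t) = tclass (hcast em en t).
Proof. by case: _ / em; case: _ / en. Qed.

Lemma free_laws : PROP_laws (fun m n => @eq (free_hom m n))
  (fun n => tclass (tid n)) free_comp free_tens
  (fun m n => tclass (tbraid m n)).
Proof.
have L := teq_laws.
split.
- move=> m n p q h g f; rewrite -(treprK h) -(treprK g) -(treprK f).
  by rewrite !free_compE; apply/tclassP; apply: (law_compA L).
- move=> m n f; rewrite -(treprK f) !free_compE.
  by apply/tclassP; apply: (law_comp1m L).
- move=> m n f; rewrite -(treprK f) !free_compE.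
  by apply/tclassP; apply: (law_compm1 L).
- by move=> m n; rewrite free_tensE; apply/tclassP; apply: (law_tens1 L).
- move=> m n p m' n' p' g f g' f'.
  rewrite -(treprK g) -(treprK f) -(treprK g') -(treprK f').
  rewrite !(free_compE, free_tensE); apply/tclassP; apply: (law_tens_comp L).
- move=> m n m' n' m'' n'' f g h.
  rewrite -(treprK h) -(treprK g) -(treprK f) !free_tensE free_hcast.
  by apply/tclassP; apply: (law_tensA L).
- move=> m n f; rewrite -(treprK f) !free_tensE free_hcast.
  by apply/tclassP; apply: (law_tens0m L).
- move=> m n f; rewrite -(treprK f) !free_tensE free_hcast.
  by apply/tclassP; apply: (law_tensm0 L).
- move=> m n m' n' f g; rewrite -(treprK g) -(treprK f).
  rewrite !(free_compE, free_tensE); apply/tclassP; apply: (law_braid_nat L).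
- by move=> m n; rewrite free_compE; apply/tclassP; apply: (law_braidK L).
- move=> m n p; rewrite !(free_tensE, free_compE, free_hcast).
  by apply/tclassP; apply: (law_braidD L).
- move=> m n p; rewrite !(free_tensE, free_compE, free_hcast).
  by apply/tclassP; apply: (law_Dbraid L).
Qed.

Definition free_PROP : PROP := MkPROP free_laws.

End FreePROP.

Section FreeLift.
Variables (S : signature) (C : PROP) (i : forall m n, S m n -> hom C m n).

Fixpoint eval m n (t : term S m n) : hom C m n :=
  match t in term _ m n return hom C m n with
  | tid0 => pid C 0
  | tid1 => pid C 1
  | tswap => pbraid C 1 1
  | tgen _ _ s => i s
  | tcomp _ _ _ g f => pcomp (eval g) (eval f)
  | ttens _ _ _ _ f g => ptens (eval f) (eval g)
  end.

Lemma eval_hcast m m' n n' (em : m = m') (en : n = n') (t : term S m n) :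
  eval (hcast em en t) = hcast em en (eval t).
Proof. by case: _ / em; case: _ / en. Qed.

Lemma hcast_id (H : nat -> nat -> Type) m n (em : m = m) (en : n = n)
  (f : H m n) : hcast em en f = f.
Proof. by rewrite !eq_axiomK. Qed.

Lemma eval_tid n : eval (tid S n) = pid C n.
Proof.
elim: n => //= n ->; exact: (law_tens1 (PROP_ax C) 1 n).
Qed.

Lemma braid_idem m n (b : hom C m n) (b' : hom C n m) (c : hom C n n) :
  pcomp b' b = pid C m -> pcomp b b' = pid C n ->
  b = pcomp c b -> c = pid C n.
Proof.
move=> bK b'K e.
rewrite -(law_compm1 (PROP_ax C) c) -b'K (law_compA (PROP_ax C)) -e.
by rewrite b'K.
Qed.

Lemma braid10 : pbraid C 1 0 = pid C 1.
Proof.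
have L := PROP_ax C.
have := law_braidD L 1 0 0.
rewrite (hcast_id (m := 1) (n := 1)) (hcast_id (m := 1) (n := 1)).
have := law_tensm0 L (pbraid C 1 0).
rewrite (hcast_id (m := 1) (n := 1)) => ->.
have := law_tens0m L (pbraid C 1 0).
rewrite (hcast_id (m := 1) (n := 1)) => -> e.
have bK := law_braidK L 1 0; have b'K := law_braidK L 0 1.
exact: (@braid_idem 1 1 (pbraid C 1 0) (pbraid C 0 1) (pbraid C 1 0) bK b'K e).
Qed.

Lemma braid01 : pbraid C 0 1 = pid C 1.
Proof.
have L := PROP_ax C.
have := law_braidK L 0 1; rewrite braid10 => e.
by rewrite -[RHS]e; symmetry; apply: (law_comp1m L (pbraid C 0 1)).
Qed.

Lemma eval_tbraid1 n : eval (tbraid1 S n) = pbraid C 1 n.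
Proof.
have L := PROP_ax C.
elim: n => [|n IHn] /=; first by rewrite -braid10.
rewrite IHn eval_tid.
have := law_braidD L 1 1 n.
by rewrite (hcast_id (m := n.+2) (n := (n + 1).+1))
  (hcast_id (m := n.+2) (n := n.+2)) => ->.
Qed.

Lemma tens_hcastr m n p p' q q' (ep : p = p') (eq : q = q')
    (f : hom C m n) (g : hom C p q) :
  ptens f (hcast ep eq g) =
  hcast (congr1 (addn m) ep) (congr1 (addn n) eq) (ptens f g).
Proof. by case: _ / ep; case: _ / eq. Qed.

Lemma comp_hcast_id m m' n n' (em : m = m') (en : n = n') (f : hom C m n) :
  pcomp (hcast (erefl n) en (pid C n)) f = hcast (erefl m) en f.
Proof. by case: _ / en; rewrite /hcast (law_comp1m (PROP_ax C)). Qed.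

Lemma hcast_hcast (H : nat -> nat -> Type) m m' m'' n n' n''
  (em : m = m') (en : n = n') (em' : m' = m'') (en' : n' = n'') (f : H m n) :
  hcast em' en' (hcast em en f) =
  hcast (etrans em em') (etrans en en') f.
Proof. by case: _ / em'; case: _ / en'. Qed.

Lemma hcast_irr (H : nat -> nat -> Type) m m' n n' (em em' : m = m')
  (en en' : n = n') (f : H m n) : hcast em en f = hcast em' en' f.
Proof. by rewrite (eq_irrelevance em em') (eq_irrelevance en en'). Qed.

Lemma braid0n n : pbraid C 0 n = hcast (erefl n) (esym (addn0 n)) (pid C n).
Proof.
have L := PROP_ax C.
elim: n => [|n IHn].
  rewrite (hcast_id (m := 0) (n := 0)).
  have := law_braidD L 0 0 0.
  rewrite (hcast_id (m := 0) (n := 0)) (hcast_id (m := 0) (n := 0)).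
  have := law_tensm0 L (pbraid C 0 0).
  rewrite (hcast_id (m := 0) (n := 0)) => ->.
  have := law_tens0m L (pbraid C 0 0).
  rewrite (hcast_id (m := 0) (n := 0)) => -> e.
  have bK := law_braidK L 0 0.
  exact: (@braid_idem 0 0 (pbraid C 0 0) (pbraid C 0 0) (pbraid C 0 0) bK bK e).
have := law_braidD L 0 1 n.
rewrite (hcast_id (m := n.+1) (n := n.+1)) braid01.
have := law_tens1 L 1 n => /= ->.
rewrite IHn tens_hcastr.
have -> : ptens (pid C 1) (pid C n) = pid C n.+1 by exact: (law_tens1 L 1 n).
move=> ->.
have -> (f : hom C n.+1 (1 + (n + 0))) : pcomp f (pid C (1 + n)) = f.
  exact: (law_compm1 L f).
rewrite hcast_hcast.
exact: (@hcast_irr (hom C) (1 + n) (1 + n) (1 + n) (1 + (n + 0)) _ erefl).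
Qed.

Lemma eval_tbraid m n : eval (tbraid S m n) = pbraid C m n.
Proof.
have L := PROP_ax C.
elim: m => [|m IHm] /=; first by rewrite eval_hcast eval_tid braid0n.
rewrite eval_hcast /= eval_hcast /= eval_tbraid1 eval_tid IHm.
by rewrite -(law_Dbraid L 1 m n).
Qed.

Lemma eval_teq m n (s t : term S m n) : teq s t -> eval s = eval t.
Proof.
have L := PROP_ax C.
move/(_ (fun m n s t => eval s = eval t)); apply.
  split=> //= [> -> // | > -> -> // | > -> -> //].
split=> >; rewrite ?eval_hcast /= ?eval_hcast /= ?eval_tbraid ?eval_tid.
- exact: (law_compA L).
- exact: (law_comp1m L).
- exact: (law_compm1 L).
- exact: (law_tens1 L).
- exact: (law_tens_comp L).
- exact: (law_tensA L).
- exact: (law_tens0m L).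
- exact: (law_tensm0 L).
- exact: (law_braid_nat L).
- exact: (law_braidK L).
- exact: (law_braidD L).
- exact: (law_Dbraid L).
Qed.

Lemma eval_trepr m n (t : term S m n) : eval (trepr (tclass t)) = eval t.
Proof. exact: eval_teq (tclassK t). Qed.

(* The only PROP morphism extending [i], by [free_lift_unique]. *)
Definition free_lift : PROP_morphism (free_PROP S) C.
Proof.
exists (fun m n (f : hom (free_PROP S) m n) => eval (trepr f)).
- by move=> n; rewrite eval_trepr eval_tid.
- by move=> m n p g f; rewrite eval_trepr.
- by move=> m n m' n' f g; rewrite eval_trepr.
- by move=> m n; rewrite eval_trepr eval_tbraid.
Defined.

Lemma free_lift_class m n (t : term S m n) :
  pmap free_lift (tclass t : hom (free_PROP S) m n) = eval t.
Proof. exact: eval_trepr. Qed.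

Lemma free_lift_gen m n (s : S m n) :
  pmap free_lift (tclass (tgen s) : hom (free_PROP S) m n) = i s.
Proof. exact: free_lift_class. Qed.

End FreeLift.

Lemma free_tid1 S : tclass (@tid1 S) = pid (free_PROP S) 1.
Proof.
have := law_tensm0 (PROP_ax (free_PROP S)) (tclass (@tid1 S)).
rewrite (hcast_id (m := 1) (n := 1)) => E; rewrite -[LHS]E.
exact: (free_tensE (@tid1 S) (tid S 0)).
Qed.

Lemma free_tswap S : tclass (@tswap S) = pbraid (free_PROP S) 1 1.
Proof.
have L := PROP_ax (free_PROP S).
have tensm0 m (t : term S m.+1 m.+1) (u : term S m.+1 m.+1) :
    hcast (addn0 m.+1) (addn0 m.+1) (ttens t tid0) = u ->
    tclass u = tclass t :> free_hom S m.+1 m.+1.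
  move=> <-; rewrite -free_hcast -(free_tensE t tid0).
  exact: (law_tensm0 L (tclass t)).
have es : tclass (ttens tswap tid0 : term S 2 2) = tclass tswap.
  by apply: tensm0; rewrite (hcast_id (m := 2) (n := 2)).
have e11 (u v : term S 1 1) : tclass u = pid (free_PROP S) 1 ->
    tclass v = pid (free_PROP S) 1 ->
    tclass (ttens u v : term S 2 2) = pid (free_PROP S) 2.
  move=> eu ev; apply: etrans (esym (free_tensE u v)) _.
  by rewrite eu ev; apply: (law_tens1 L 1 1).
have comp1m (t u : term S 2 2) : tclass t = pid (free_PROP S) 2 ->
    tclass (tcomp t u) = tclass u.
  by move=> et; rewrite -free_compE et; apply: (law_comp1m L (tclass u)).
have compm1 (t u : term S 2 2) : tclass u = pid (free_PROP S) 2 ->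
    tclass (tcomp t u) = tclass t.
  by move=> eu; rewrite -free_compE eu; apply: (law_compm1 L (tclass t)).
have B1 : tclass (tbraid1 S 1) = tclass (@tswap S).
  by apply: etrans es; apply: comp1m; apply: e11; apply: free_tid1.
have B1' : tclass (ttens (tbraid1 S 1) tid0 : term S 2 2) = tclass tswap.
  by rewrite -B1; apply: tensm0; rewrite (hcast_id (m := 2) (n := 2)).
rewrite /= (hcast_id (m := 2) (n := 2)) (hcast_id (m := 2) (n := 2)).
rewrite (hcast_id (m := 1) (n := 1)).
apply: esym; apply: etrans B1'; exact: compm1.
Qed.

Lemma free_lift_unique S (C : PROP) (F G : PROP_morphism (free_PROP S) C) :
  (forall m n (s : S m n), pmap F (tclass (tgen s) : hom (free_PROP S) m n) =
     pmap G (tclass (tgen s) : hom (free_PROP S) m n)) ->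
  morph_eq F G.
Proof.
move=> FG m n f; rewrite -(treprK f); move: (trepr f) => t {f}.
elim: t => [||| {}m {}n s | {}m {}n p g IHg f IHf
           | {}m {}n m' n' f IHf g IHg].
- by rewrite (pmap_id F 0) (pmap_id G 0).
- by rewrite free_tid1 !pmap_id.
- by rewrite free_tswap (pmap_braid F 1 1) (pmap_braid G 1 1).
- exact: FG.
- by rewrite -free_compE (pmap_comp F) (pmap_comp G) IHg IHf.
- by rewrite -free_tensE (pmap_tens F) (pmap_tens G) IHg IHf.
Qed.

Definition equations (S : signature) : Type :=
  forall m n, term S m n -> term S m n -> Prop.

Definition eqn_signature S (E : equations S) : signature :=
  fun m n => {e : term S m n * term S m n | E m n e.1 e.2}.

Definition lhs_morphism S (E : equations S) :
    PROP_morphism (free_PROP (eqn_signature E)) (free_PROP S) :=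
  @free_lift (eqn_signature E) (free_PROP S)
    (fun m n e => tclass (sval e).1).

Definition rhs_morphism S (E : equations S) :
    PROP_morphism (free_PROP (eqn_signature E)) (free_PROP S) :=
  @free_lift (eqn_signature E) (free_PROP S)
    (fun m n e => tclass (sval e).2).

Import GRing.Theory.
Local Open Scope ring_scope.

(* The set of all [f x], as a subspace.  [linfun f] only agrees with [f] when
   [f] is linear, as in all uses below; see [memv_lrange]. *)
Definition lrange (k : fieldType) (U V : vectType k) (f : U -> V) :
  {vspace V} := limg (linfun f).

Lemma linfun_linear (k : fieldType) (U V : vectType k) (f : U -> V) :
  linear f -> linfun f =1 f.
Proof.
move=> lf.
pose g : {linear U -> V} :=
  HB.pack f (GRing.isLinear.Build k U V *:%R f lf).
by move=> x; rewrite (lfunE g).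
Qed.

Lemma memv_lrange (k : fieldType) (U V : vectType k) (f : U -> V) w :
  linear f -> reflect (exists x, w = f x) (w \in lrange f).
Proof.
move=> lf; apply: (iffP memv_imgP) => [[x _ ->] | [x ->]]; exists x => //.
- exact: linfun_linear.
- exact: memvf.
- by rewrite linfun_linear.
Qed.

Section LinRel.
Variable k : fieldType.

(* k^m is ['rV[k]_m], and k^m (+) k^n is identified with k^(m + n) by
   [row_mx]. *)
Definition linrel (m n : nat) : Type := {vspace ('rV[k]_m * 'rV[k]_n)%type}.

Definition linrel_id n : linrel n n := lrange (fun x : 'rV[k]_n => (x, x)).

(* The image in U (+) W of the triples (u, v, w) with (u, v) in L and (v, w)
   in L', see [mem_linrel_comp]. *)
Definition linrel_comp m n p (L' : linrel n p) (L : linrel m n) :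
    linrel m p :=
  let pUV := linfun (fun t : 'rV[k]_m * 'rV[k]_n * 'rV[k]_p => t.1) in
  let pVW := linfun (fun t : 'rV[k]_m * 'rV[k]_n * 'rV[k]_p => (t.1.2, t.2)) in
  let pUW := linfun (fun t : 'rV[k]_m * 'rV[k]_n * 'rV[k]_p => (t.1.1, t.2)) in
  (pUW @: (pUV @^-1: L :&: pVW @^-1: L'))%VS.

Definition linrel_tens m n m' n' (L : linrel m n) (L' : linrel m' n') :
    linrel (m + m') (n + n') :=
  let p := linfun (fun t : 'rV[k]_(m + m') * 'rV[k]_(n + n') =>
                     (lsubmx t.1, lsubmx t.2)) in
  let p' := linfun (fun t : 'rV[k]_(m + m') * 'rV[k]_(n + n') =>
                      (rsubmx t.1, rsubmx t.2)) in
  (p @^-1: L :&: p' @^-1: L')%VS.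

Definition linrel_braid m n : linrel (m + n) (n + m) :=
  lrange (fun t : 'rV[k]_m * 'rV[k]_n => (row_mx t.1 t.2, row_mx t.2 t.1)).

Lemma linrelP m n (L L' : linrel m n) :
  (forall u v, ((u, v) \in L) = ((u, v) \in L')) -> L = L'.
Proof. by move=> e; apply/vspaceP => -[u v]; apply: e. Qed.

Lemma mem_linrel_id n u v : ((u, v) \in linrel_id n) = (v == u).
Proof.
have lf : linear (fun x : 'rV[k]_n => (x, x)) by [].
by apply/(memv_lrange _ lf)/eqP => [[x [-> ->]] | ->]; [|exists u].
Qed.

Lemma mem_linrel_comp m n p (L' : linrel n p) (L : linrel m n) u w :
  reflect (exists v, (u, v) \in L /\ (v, w) \in L')
          ((u, w) \in linrel_comp L' L).
Proof.
have l1 : linear (fun t : 'rV[k]_m * 'rV[k]_n * 'rV[k]_p => t.1) by [].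
have l2 : linear (fun t : 'rV[k]_m * 'rV[k]_n * 'rV[k]_p => (t.1.2, t.2)).
  by [].
have l3 : linear (fun t : 'rV[k]_m * 'rV[k]_n * 'rV[k]_p => (t.1.1, t.2)).
  by [].
apply: (iffP memv_imgP) => [[[[u' v] w']] | [v [Luv Lvw]]].
  rewrite memv_cap -!memv_preim !linfun_linear //= => /andP[Luv Lvw] [-> ->].
  by exists v.
exists (u, v, w); last by rewrite linfun_linear.
by rewrite memv_cap -!memv_preim !linfun_linear //= Luv Lvw.
Qed.

Lemma mem_linrel_tens m n m' n' (L : linrel m n) (L' : linrel m' n') u v :
  ((u, v) \in linrel_tens L L') =
  ((lsubmx u, lsubmx v) \in L) && ((rsubmx u, rsubmx v) \in L').
Proof.
rewrite memv_cap -!memv_preim !linfun_linear // => c [u1 v1] [u2 v2] /=.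
  by congr pair; rewrite linearP.
by congr pair; rewrite linearP.
Qed.

Lemma mem_linrel_tens_row m n m' n' (L : linrel m n) (L' : linrel m' n')
    u u' v v' :
  ((row_mx u u', row_mx v v') \in linrel_tens L L') =
  ((u, v) \in L) && ((u', v') \in L').
Proof. by rewrite mem_linrel_tens !row_mxKl !row_mxKr. Qed.

Lemma mem_linrel_braid m n u v :
  ((u, v) \in linrel_braid m n) = (v == row_mx (rsubmx u) (lsubmx u)).
Proof.
have lf : linear (fun t : 'rV[k]_m * 'rV[k]_n =>
    (row_mx t.1 t.2, row_mx t.2 t.1)).
  by move=> c [x y] [x' y']; rewrite /= -!add_row_mx -!scale_row_mx.
apply/(memv_lrange _ lf)/eqP => [[[x y] /= [-> ->]] | ->].
  by rewrite row_mxKl row_mxKr.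
by exists (lsubmx u, rsubmx u); rewrite /= hsubmxK.
Qed.

Lemma mem_linrel_hcast m m' n n' (em : m = m') (en : n = n')
    (L : linrel m n) u v :
  ((u, v) \in hcast (H := linrel) em en L) =
  ((castmx (erefl, esym em) u, castmx (erefl, esym en) v) \in L).
Proof. by case: _ / em u; case: _ / en v => u v; rewrite !castmx_id. Qed.

Lemma castmx_row3 a b c (e : (a + (b + c) = a + b + c)%N)
    (x : 'rV[k]_a) (y : 'rV[k]_b) (z : 'rV[k]_c) :
  castmx (erefl, e) (row_mx x (row_mx y z)) = row_mx (row_mx x y) z.
Proof.
by rewrite row_mxA castmx_comp castmx_id.
Qed.

Lemma castmx_row3V a b c (e : (a + b + c = a + (b + c))%N)
    (x : 'rV[k]_a) (y : 'rV[k]_b) (z : 'rV[k]_c) :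
  castmx (erefl, e) (row_mx (row_mx x y) z) = row_mx x (row_mx y z).
Proof. by rewrite (eq_irrelevance e (esym (addnA a b c))) row_mxA. Qed.

Lemma linrel_laws : PROP_laws (fun m n => @eq (linrel m n))
  linrel_id linrel_comp linrel_tens linrel_braid.
Proof.
split.
- move=> m n p q h g f; apply: linrelP => u v.
  apply/mem_linrel_comp/mem_linrel_comp.
    move=> [y [/mem_linrel_comp[x [fx gx]] hx]]; exists x; split=> //.
    by apply/mem_linrel_comp; exists y.
  move=> [x [fx /mem_linrel_comp[y [gx hx]]]]; exists y; split=> //.
  by apply/mem_linrel_comp; exists x.
- move=> m n f; apply: linrelP => u v; apply/mem_linrel_comp/idP.
    by move=> [x [fx]]; rewrite mem_linrel_id => /eqP ->.
  by move=> fx; exists v; rewrite mem_linrel_id.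
- move=> m n f; apply: linrelP => u v; apply/mem_linrel_comp/idP.
    by move=> [x []]; rewrite mem_linrel_id => /eqP ->.
  by move=> fx; exists u; rewrite mem_linrel_id.
- move=> m n; apply: linrelP => u v.
  rewrite mem_linrel_tens !mem_linrel_id; apply/andP/eqP => [|-> //].
  by case=> /eqP e1 /eqP e2; rewrite -[v]hsubmxK e1 e2 hsubmxK.
- move=> m n p m' n' p' g f g' f'; apply: linrelP => u w.
  rewrite mem_linrel_tens; apply/andP/mem_linrel_comp.
    case=> /mem_linrel_comp[x [fx gx]] /mem_linrel_comp[x' [fx' gx']].
    by exists (row_mx x x'); rewrite !mem_linrel_tens !row_mxKl !row_mxKr;
      rewrite fx gx fx' gx'.
  case=> v []; rewrite !mem_linrel_tens => /andP[f1 f2] /andP[g1 g2].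
  by split; apply/mem_linrel_comp; [exists (lsubmx v)|exists (rsubmx v)].
- move=> m n m' n' m'' n'' f g h; apply: linrelP => u v.
  rewrite mem_linrel_hcast !mem_linrel_tens andbA.
  have E1 a b c (x : 'rV[k]_(a + b + c)) :
      lsubmx (castmx (erefl, esym (addnA a b c)) x) = lsubmx (lsubmx x).
    by apply/rowP=> i; rewrite !mxE castmxE; congr (x _ _); apply: val_inj.
  have E2 a b c (x : 'rV[k]_(a + b + c)) :
      lsubmx (rsubmx (castmx (erefl, esym (addnA a b c)) x)) =
      rsubmx (lsubmx x).
    by apply/rowP=> i; rewrite !mxE castmxE; congr (x _ _); apply: val_inj.
  have E3 a b c (x : 'rV[k]_(a + b + c)) :
      rsubmx (rsubmx (castmx (erefl, esym (addnA a b c)) x)) = rsubmx x.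
    apply/rowP=> i; rewrite !mxE castmxE; congr (x _ _); apply: val_inj.
      by [].
    exact: addnA.
  by rewrite !E1 !E2 !E3.
- move=> m n f; apply: linrelP => u v.
  rewrite mem_linrel_hcast mem_linrel_tens mem_linrel_id.
  rewrite [X in X == _]thinmx0 [X in _ == X]thinmx0 eqxx /=.
  have E a (x : 'rV[k]_a) :
      rsubmx (castmx (erefl, esym (add0n a)) x : 'rV_(0 + a)) = x.
    by apply/rowP=> i; rewrite !mxE castmxE; congr (x _ _); apply: val_inj.
  by rewrite !E.
- move=> m n f; apply: linrelP => u v.
  rewrite mem_linrel_hcast mem_linrel_tens mem_linrel_id.
  rewrite [X in X == _]thinmx0 [X in _ == X]thinmx0 eqxx andbT.
  have E a (x : 'rV[k]_a) :
      lsubmx (castmx (erefl, esym (addn0 a)) x : 'rV_(a + 0)) = x.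
    by apply/rowP=> i; rewrite !mxE castmxE; congr (x _ _); apply: val_inj.
  by rewrite !E.
- move=> m n m' n' f g; apply: linrelP => u v.
  apply/mem_linrel_comp/mem_linrel_comp.
    case=> x []; rewrite mem_linrel_tens mem_linrel_braid => /andP[fx gx].
    move=> /eqP ->; exists (row_mx (rsubmx u) (lsubmx u)).
    by rewrite mem_linrel_braid mem_linrel_tens_row fx gx.
  case=> x []; rewrite mem_linrel_braid mem_linrel_tens => /eqP ->.
  rewrite row_mxKl row_mxKr => /andP[gx fx].
  exists (row_mx (rsubmx v) (lsubmx v)).
  rewrite mem_linrel_tens mem_linrel_braid !row_mxKl !row_mxKr fx gx.
  by rewrite hsubmxK.
- move=> m n; apply: linrelP => u v; rewrite mem_linrel_id.
  apply/mem_linrel_comp/eqP => [[x []] | ->].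
    rewrite !mem_linrel_braid => /eqP -> /eqP ->.
    by rewrite row_mxKl row_mxKr hsubmxK.
  exists (row_mx (rsubmx u) (lsubmx u)).
  by rewrite !mem_linrel_braid row_mxKl row_mxKr hsubmxK.
- move=> m n p; apply: linrelP => u v.
  rewrite -[u]hsubmxK -[rsubmx u]hsubmxK -[v]hsubmxK -[lsubmx v]hsubmxK.
  move: (lsubmx u) (lsubmx (rsubmx u)) (rsubmx (rsubmx u)) => a b c.
  move: (lsubmx (lsubmx v)) (rsubmx (lsubmx v)) (rsubmx v) => b' c' a'.
  rewrite mem_linrel_hcast mem_linrel_braid castmx_row3 castmx_row3V.
  rewrite row_mxKl row_mxKr; apply/eqP/mem_linrel_comp => [|[x []]].
    move=> /eq_row_mx[/eq_row_mx[-> ->] ->]; exists (row_mx b (row_mx a c)).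
    rewrite mem_linrel_hcast castmx_id castmx_row3 !mem_linrel_tens_row.
    by rewrite !mem_linrel_id !mem_linrel_braid !row_mxKl !row_mxKr !eqxx.
  rewrite -[x]hsubmxK -[rsubmx x]hsubmxK.
  move: (lsubmx x) (lsubmx (rsubmx x)) (rsubmx (rsubmx x)) => b1 a1 c1.
  rewrite mem_linrel_hcast castmx_id castmx_row3 !mem_linrel_tens_row.
  rewrite !mem_linrel_id !mem_linrel_braid !row_mxKl !row_mxKr.
  move=> /andP[/eqP/eq_row_mx[-> ->] /eqP ->].
  by move=> /andP[/eqP -> /eqP/eq_row_mx[-> ->]].
- move=> m n p; apply: linrelP => u v.
  rewrite -[u]hsubmxK -[lsubmx u]hsubmxK -[v]hsubmxK -[rsubmx v]hsubmxK.
  move: (lsubmx (lsubmx u)) (rsubmx (lsubmx u)) (rsubmx u) => a b c.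
  move: (lsubmx v) (lsubmx (rsubmx v)) (rsubmx (rsubmx v)) => c' a' b'.
  rewrite mem_linrel_hcast mem_linrel_braid castmx_row3 castmx_row3V.
  rewrite row_mxKl row_mxKr; apply/eqP/mem_linrel_comp => [|[x []]].
    move=> /eq_row_mx[-> /eq_row_mx[-> ->]]; exists (row_mx (row_mx a c) b).
    rewrite mem_linrel_hcast castmx_id castmx_row3V !mem_linrel_tens_row.
    by rewrite !mem_linrel_id !mem_linrel_braid !row_mxKl !row_mxKr !eqxx.
  rewrite -[x]hsubmxK -[lsubmx x]hsubmxK.
  move: (lsubmx (lsubmx x)) (rsubmx (lsubmx x)) (rsubmx x) => a1 c1 b1.
  rewrite mem_linrel_hcast castmx_id castmx_row3V !mem_linrel_tens_row.
  rewrite !mem_linrel_id !mem_linrel_braid !row_mxKl !row_mxKr.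
  move=> /andP[/eqP -> /eqP/eq_row_mx[-> ->]].
  by move=> /andP[/eqP/eq_row_mx[-> ->] /eqP ->].
Qed.

Definition FinRel : PROP := MkPROP linrel_laws.

End LinRel.

Inductive FR_symbol (k : fieldType) : signature :=
| sym_s of k : FR_symbol k 1 1
| sym_mu : FR_symbol k 2 1
| sym_zeta : FR_symbol k 0 1
| sym_Delta : FR_symbol k 1 2
| sym_bang : FR_symbol k 1 0
| sym_cup : FR_symbol k 2 0
| sym_cap : FR_symbol k 0 2.

Section FinRelPresentation.
Variable k : fieldType.

Definition rel_s (c : k) : linrel k 1 1 :=
  lrange (fun x : 'rV[k]_1 => (x, c *: x)).
Definition rel_mu : linrel k 2 1 :=
  lrange (fun t : 'rV[k]_1 * 'rV[k]_1 =>
            (row_mx t.1 t.2 : 'rV_2, t.1 + t.2)).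
Definition rel_zeta : linrel k 0 1 := 0%VS.
Definition rel_Delta : linrel k 1 2 :=
  lrange (fun x : 'rV[k]_1 => (x, row_mx x x : 'rV_2)).
Definition rel_bang : linrel k 1 0 :=
  lrange (fun x : 'rV[k]_1 => (x, 0 : 'rV_0)).
Definition rel_cup : linrel k 2 0 :=
  lrange (fun x : 'rV[k]_1 => (row_mx x x : 'rV_2, 0 : 'rV_0)).
Definition rel_cap : linrel k 0 2 :=
  lrange (fun x : 'rV[k]_1 => (0 : 'rV_0, row_mx x x : 'rV_2)).

Definition FR_interp m n (g : FR_symbol k m n) : hom (FinRel k) m n :=
  match g in FR_symbol _ m n return linrel k m n with
  | sym_s c => rel_s c
  | sym_mu => rel_mu
  | sym_zeta => rel_zeta
  | sym_Delta => rel_Delta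
  | sym_bang => rel_bang
  | sym_cup => rel_cup
  | sym_cap => rel_cap
  end.

Lemma mem_rel_s c x y : ((x, y) \in rel_s c) = (y == c *: x).
Proof.
have lf : linear (fun x : 'rV[k]_1 => (x, c *: x)).
  by move=> a u v; congr pair; rewrite /= scalerDr !scalerA mulrC.
by apply/(memv_lrange _ lf)/eqP => [[z [-> ->]] | ->]; [|exists x].
Qed.

Lemma mem_rel_mu (x y z : 'rV[k]_1) :
  ((row_mx x y : 'rV_2, z) \in rel_mu) = (z == x + y).
Proof.
have lf : linear (fun t : 'rV[k]_1 * 'rV[k]_1 =>
    (row_mx t.1 t.2 : 'rV_2, t.1 + t.2)).
  move=> a [u u'] [v v'] /=; congr pair.
    by rewrite -(add_row_mx (n1 := 1)) -(scale_row_mx (n1 := 1)).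
  by rewrite /= scalerDr addrACA.
apply/(memv_lrange _ lf)/eqP => [[[u v] /= [e ->]] | ->].
  by have [-> ->] := @eq_row_mx k 1 1 1 _ _ _ _ e.
by exists (x, y).
Qed.

Lemma mem_rel_zeta u x : ((u, x) \in rel_zeta) = (x == 0).
Proof. by rewrite memv0 [u]thinmx0 -pair_eqE /= eqxx. Qed.

Lemma dup_linear a (u v : 'rV[k]_1) :
  row_mx (a *: u + v) (a *: u + v) = a *: row_mx u u + row_mx v v.
Proof. by rewrite -add_row_mx -scale_row_mx. Qed.

Lemma mem_rel_Delta (x y z : 'rV[k]_1) :
  ((x, row_mx y z : 'rV_2) \in rel_Delta) = (y == x) && (z == x).
Proof.
have lf : linear (fun x : 'rV[k]_1 => (x, row_mx x x : 'rV_2)).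
  by move=> a u v; congr pair; apply: dup_linear.
apply/(memv_lrange _ lf)/andP => [[u [-> e]] | [/eqP -> /eqP ->]].
  by have [-> ->] := @eq_row_mx k 1 1 1 _ _ _ _ e.
by exists x.
Qed.

Lemma mem_rel_bang x u : (x, u) \in rel_bang.
Proof.
have lf : linear (fun x : 'rV[k]_1 => (x, 0 : 'rV[k]_0)).
  by move=> a v w; congr pair; rewrite /= scaler0 addr0.
by apply/(memv_lrange _ lf); exists x; rewrite [u]thinmx0.
Qed.

Lemma mem_rel_cup (x y : 'rV[k]_1) u :
  ((row_mx x y : 'rV_2, u) \in rel_cup) = (x == y).
Proof.
have lf : linear (fun x : 'rV[k]_1 => (row_mx x x : 'rV_2, 0 : 'rV[k]_0)).
  move=> a v w; congr pair; first exact: dup_linear.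
  by rewrite /= scaler0 addr0.
apply/(memv_lrange _ lf)/eqP => [[z [e _]] | ->].
  by have [-> ->] := @eq_row_mx k 1 1 1 _ _ _ _ e.
by exists y; rewrite [u]thinmx0.
Qed.

Lemma mem_rel_cap (x y : 'rV[k]_1) u :
  ((u, row_mx x y : 'rV_2) \in rel_cap) = (x == y).
Proof.
have lf : linear (fun x : 'rV[k]_1 => (0 : 'rV[k]_0, row_mx x x : 'rV_2)).
  move=> a v w; congr pair; last exact: dup_linear.
  by rewrite /= scaler0 addr0.
apply/(memv_lrange _ lf)/eqP => [[z [_ e]] | ->].
  by have [-> ->] := @eq_row_mx k 1 1 1 _ _ _ _ e.
by exists y; rewrite [u]thinmx0.
Qed.

Local Notation T := (term (FR_symbol k)).

Definition t_s (c : k) : T 1 1 := tgen (sym_s c).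
Definition t_mu : T 2 1 := tgen (sym_mu k).
Definition t_zeta : T 0 1 := tgen (sym_zeta k).
Definition t_Delta : T 1 2 := tgen (sym_Delta k).
Definition t_bang : T 1 0 := tgen (sym_bang k).
Definition t_cup : T 2 0 := tgen (sym_cup k).
Definition t_cap : T 0 2 := tgen (sym_cap k).

Local Open Scope diagram_scope.

Local Notation id0 := tid0.
Local Notation id1 := tid1.
Local Notation B := tswap.
Local Notation s := t_s.
Local Notation μ := t_mu.
Local Notation ζ := t_zeta.
Local Notation Δ := t_Delta.
Local Notation bang := t_bang.
Local Notation "∪" := t_cup : diagram_scope.
Local Notation "∩" := t_cap : diagram_scope.

Definition mu_dag : T 1 2 :=
  (id1 ⊕ id1 ⊕ ∪) ∘ (id1 ⊕ id1 ⊕ μ ⊕ id1) ∘ (((id1 ⊕ ∩ ⊕ id1) ∘ ∩) ⊕ id1).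
Definition zeta_dag : T 1 0 := ∪ ∘ (ζ ⊕ id1).
Definition Delta_dag : T 2 1 :=
  ((∪ ∘ (id1 ⊕ ∪ ⊕ id1)) ⊕ id1) ∘ (id1 ⊕ id1 ⊕ Δ ⊕ id1) ∘ (id1 ⊕ id1 ⊕ ∩).
Definition bang_dag : T 0 1 := (bang ⊕ id1) ∘ ∩.
Definition s_dag (c : k) : T 1 1 := (∪ ⊕ id1) ∘ (id1 ⊕ s c ⊕ id1) ∘ (id1 ⊕ ∩).

Local Notation "μ†" := mu_dag : diagram_scope.
Local Notation "ζ†" := zeta_dag : diagram_scope.
Local Notation "Δ†" := Delta_dag : diagram_scope.
Local Notation "bang†" := bang_dag : diagram_scope.

Inductive FR_equations : equations (FR_symbol k) :=
| eqn01 : @FR_equations 1 1 (μ ∘ (ζ ⊕ id1)) id1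
| eqn02 : @FR_equations 3 1 (μ ∘ (id1 ⊕ μ)) (μ ∘ (μ ⊕ id1))
| eqn03 : @FR_equations 2 1 (μ ∘ B) μ
| eqn04 : @FR_equations 1 1 ((bang ⊕ id1) ∘ Δ) id1
| eqn05 : @FR_equations 1 3 ((id1 ⊕ Δ) ∘ Δ) ((Δ ⊕ id1) ∘ Δ)
| eqn06 : @FR_equations 1 2 (B ∘ Δ) Δ
| eqn07 : @FR_equations 2 2 (Δ ∘ μ) ((μ ⊕ μ) ∘ (id1 ⊕ B ⊕ id1) ∘ (Δ ⊕ Δ))
| eqn08 : @FR_equations 0 2 (Δ ∘ ζ) (ζ ⊕ ζ)
| eqn09 : @FR_equations 2 0 (bang ∘ μ) (bang ⊕ bang)
| eqn10 : @FR_equations 0 0 (bang ∘ ζ) id0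
| eqn11 (b c : k) : @FR_equations 1 1 (s (b * c)%R) (s b ∘ s c)
| eqn12 (b c : k) : @FR_equations 1 1 (s (b + c)%R) (μ ∘ (s b ⊕ s c) ∘ Δ)
| eqn13 : @FR_equations 1 1 (s 1%R) id1
| eqn14 : @FR_equations 1 1 (s 0%R) (ζ ∘ bang)
| eqn15 (c : k) : @FR_equations 2 1 (μ ∘ (s c ⊕ s c)) (s c ∘ μ)
| eqn16 (c : k) : @FR_equations 0 1 (s c ∘ ζ) ζ
| eqn17 (c : k) : @FR_equations 1 2 ((s c ⊕ s c) ∘ Δ) (Δ ∘ s c)
| eqn18 (c : k) : @FR_equations 1 0 (bang ∘ s c) bang
| eqn19 : @FR_equations 1 1 ((∪ ⊕ id1) ∘ (id1 ⊕ ∩)) id1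
| eqn20 : @FR_equations 1 1 id1 ((id1 ⊕ ∪) ∘ (∩ ⊕ id1))
| eqn21 : @FR_equations 2 2 ((μ ⊕ id1) ∘ (id1 ⊕ μ†)) (μ† ∘ μ)
| eqn22 : @FR_equations 2 2 (μ† ∘ μ) ((id1 ⊕ μ) ∘ (μ† ⊕ id1))
| eqn23 : @FR_equations 2 2 ((Δ† ⊕ id1) ∘ (id1 ⊕ Δ)) (Δ ∘ Δ†)
| eqn24 : @FR_equations 2 2 (Δ ∘ Δ†) ((id1 ⊕ Δ†) ∘ (Δ ⊕ id1))
| eqn25 : @FR_equations 1 1 (μ ∘ μ†) id1
| eqn26 : @FR_equations 0 0 (ζ† ∘ ζ) id0
| eqn27 : @FR_equations 1 1 (Δ† ∘ Δ) id1
| eqn28 : @FR_equations 0 0 (bang ∘ bang†) id0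
| eqn29 : @FR_equations 2 0 (∪ ∘ (s (-1)%R ⊕ id1)) (ζ† ∘ μ)
| eqn30 : @FR_equations 0 2 ∩ (Δ ∘ bang†)
| eqn31 (c : k) : c != 0%R -> @FR_equations 1 1 (s_dag c) (s (c^-1)%R).

End FinRelPresentation.

Arguments FR_equations k : clear implicits.

(* Main.v *)
Require Import Defs.
From mathcomp Require Import all_boot all_order all_algebra.
From mathcomp Require Import boolp ring.
Import Defs.

Set Implicit Arguments.
Unset Strict Implicit.
Unset Printing Implicit Defensive.

Import GRing.Theory.

Local Notation "g · f" := (pcomp g f) (at level 41, right associativity).

(** A diagram is determined, modulo the equations, by the subspace it denotes
    because every diagram without inputs has a normal form [state A], attached
    to a list A of vectors of k^n: it denotes the span of A, and modulo the
    equations it depends on nothing else.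

    The linear map [shear v] : (c, x) |-> (c, x + c v) gives, when its control
    wire c is fed with !† and then discarded, the relation
    [smear v] = {(x, x + c v)}; [state A] is the composite of the [smear v],
    v in A, applied to the zero vector.  Everything follows from one sliding
    rule, [lin_shear_comm]: a diagram f made of μ, ζ, Δ, !, s_c and crossings,
    denoting the linear map l, satisfies
      (1 ⊕ f) ∘ shear v = shear (l v) ∘ (1 ⊕ f).
    As a shear is itself such a diagram, smears commute with each other, and a
    state absorbs every vector of its span ([absorbs_span]); so two lists with
    the same span give the same state ([state_span]).  Applying f to [state A]
    gives the state of the images of A.  Composing with !† adds a vector to A,
    and ζ† cuts out a hyperplane, which is one step of Gaussian elimination
    ([zetad_preserves]).  Cups and caps reduce to ζ† and !†, hence every
    diagram 0 -> n equals some [state A] ([eval_state]).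

    The universal property follows.  Given a PROP D in which the equations
    hold, the normal form is computed in the product of D and FinRel, so that
    one list A serves in both.  Two diagrams 0 -> n with the same denotation
    then have lists with the same span, hence the same value in D
    ([state_complete]).  Inputs are bent into outputs one at a time, which is
    reversible by the zigzag equations; this extends completeness to all
    diagrams ([complete]), and shows that every linear relation is denoted by
    a diagram ([q_full]), since every subspace is the span of a finite list.
    The mediating morphism sends a relation to the value in D of any diagram
    that denotes it. *)

(** * Diagrams as composites of layers *)

(** Diagrams are composites of layers: a generator with wires on both sides.
    The wires on the left are added one at a time by [W], those on the right
    all at once by [padr].  Since 1 + n and n.+1 are convertible, the
    associativity casts of a strict monoidal category vanish in this form.
    Equations between composites are stated with an arbitrary morphism [x]
    composed on the right, so that they rewrite inside right-associated
    composites. *)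
Section Wires.
Variable C : PROP.
Local Notation H := (hom C).
Local Notation idm := (pid C).
Let L := PROP_ax C.

Lemma compA m n p q (h : H p q) (g : H n p) (f : H m n) :
  (h · g) · f = h · g · f.
Proof. by rewrite (law_compA L). Qed.
Lemma comp1 m n (f : H m n) : idm n · f = f.
Proof. exact: law_comp1m L _ _ f. Qed.
Lemma compf1 m n (f : H m n) : f · idm m = f.
Proof. exact: law_compm1 L _ _ f. Qed.

Lemma eq_tail m n (f g : H m n) :
  (forall p (x : H p m), f · x = g · x) -> f = g.
Proof. by move=> /(_ _ (idm m)); rewrite !compf1. Qed.

Lemma tens11 m n : ptens (idm m) (idm n) = idm (m + n).
Proof. exact: law_tens1 L m n. Qed.

Lemma interchange m n p m' n' p' (g : H n p) (f : H m n) (g' : H n' p')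
  (f' : H m' n') :
  ptens (g · f) (g' · f') = ptens g g' · ptens f f'.
Proof. exact: law_tens_comp L _ _ _ _ _ _ g f g' f'. Qed.

Definition W m n (f : H m n) : H m.+1 n.+1 := ptens (idm 1) f.

Lemma W_id n : W (idm n) = idm n.+1.
Proof. exact: (tens11 1 n). Qed.

Lemma W_comp m n p (g : H n p) (f : H m n) : W (g · f) = W g · W f.
Proof. by have := interchange (idm 1) (idm 1) g f; rewrite comp1. Qed.

Definition padr i j (g : H i j) n : H (i + n) (j + n) := ptens g (idm n).

Lemma padr_id i n : padr (idm i) n = idm (i + n).
Proof. exact: (tens11 i n). Qed.

Lemma padr_comp a b c (g : H b c) (f : H a b) n :
  padr (g · f) n = padr g n · padr f n.
Proof. by rewrite /padr -interchange comp1. Qed.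

Lemma tens_padr a b c d (g : H a b) (f : H c d) :
  ptens g f = padr g d · ptens (idm a) f.
Proof. by rewrite /padr -interchange comp1 compf1. Qed.

Lemma tens_padr' a b c d (g : H a b) (f : H c d) :
  ptens g f = ptens (idm b) f · padr g c.
Proof. by rewrite /padr -interchange comp1 compf1. Qed.

Lemma padr_nat a b (g : H a b) m n (f : H m n) :
  padr g n · ptens (idm a) f = ptens (idm b) f · padr g m.
Proof. by rewrite -tens_padr tens_padr'. Qed.

Lemma comp_tail m n p q (g : H n p) (f : H m n) (h : H m p) (x : H q m) :
  g · f = h -> g · f · x = h · x.
Proof. by move=> <-; rewrite compA. Qed.

Lemma comp_tail2 m n n' p q (g : H n p) (f : H m n) (g' : H n' p) (f' : H m n')
  (x : H q m) :
  g · f = g' · f' -> g · f · x = g' · f' · x.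
Proof. by move=> /(comp_tail x) ->; rewrite compA. Qed.

Lemma padr_W a b (f : H a b) n : padr (W f) n = W (padr f n).
Proof.
rewrite /padr /W.
have := law_tensA L (idm 1) f (idm n).
by rewrite (hcast_id (m := 1 + (a + n)) (n := 1 + (b + n))) => ->.
Qed.

Lemma tens0f m n (f : H m n) : ptens (idm 0) f = f.
Proof.
have := law_tens0m L f.
by rewrite (hcast_id (m := m) (n := n)).
Qed.

Lemma tens2f m n (f : H m n) : ptens (idm 2) f = W (W f).
Proof.
have := law_tensA L (idm 1) (idm 1) f.
rewrite (hcast_id (m := m.+2) (n := n.+2)).
have -> : ptens (idm 1) (idm 1) = idm 2 by apply: (tens11 1 1).
by move=> <-.
Qed.

Lemma padrS a b (f : H a b) n :
  padr (ptens f (idm 1)) n =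
  hcast (addnA a 1 n) (addnA b 1 n) (padr f n.+1).
Proof.
rewrite /padr -(law_tensA L f (idm 1) (idm n)).
by congr (hcast _ _ (ptens f _)); apply: (tens11 1 n).
Qed.

End Wires.

(** * The equations in layered form *)

Section Gens.
Variables (k : fieldType) (C : PROP).
Variable i : forall m n, FR_symbol k m n -> hom C m n.
Local Notation H := (hom C).

Definition mu_ n : H n.+2 n.+1 := padr (i (sym_mu k)) n.
Definition zeta_ n : H n n.+1 := padr (i (sym_zeta k)) n.
Definition delta_ n : H n.+1 n.+2 := padr (i (sym_Delta k)) n.
Definition bang_ n : H n.+1 n := padr (i (sym_bang k)) n.
Definition cup_ n : H n.+2 n := padr (i (sym_cup k)) n.
Definition cap_ n : H n n.+2 := padr (i (sym_cap k)) n.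
Definition s_ c n : H n.+1 n.+1 := padr (i (sym_s c)) n.
Definition swap_ n : H n.+2 n.+2 := padr (pbraid C 1 1) n.
(** ζ† and !† in layered form, see [padr_zetad] and [padr_bangd]. *)
Definition zetad_ n : H n.+1 n := cup_ n · zeta_ n.+1.
Definition bangd_ n : H n n.+1 := bang_ n.+1 · cap_ n.

(** Interchange: disjoint layers slide past each other. *)
Section Nat.
Variables (m n : nat) (f : H m n).
Lemma zeta_nat p (x : H p m) : zeta_ n · f · x = W f · zeta_ m · x.
Proof.
by apply: comp_tail2; have := padr_nat (i (sym_zeta k)) f;
  rewrite ?(tens0f, tens2f).
Qed.
Lemma mu_nat p (x : H p m.+2) : mu_ n · W (W f) · x = W f · mu_ m · x.
Proof.
by apply: comp_tail2; have := padr_nat (i (sym_mu k)) f;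
  rewrite ?(tens0f, tens2f).
Qed.
Lemma delta_nat p (x : H p m.+1) : delta_ n · W f · x = W (W f) · delta_ m · x.
Proof.
by apply: comp_tail2; have := padr_nat (i (sym_Delta k)) f;
  rewrite ?(tens0f, tens2f).
Qed.
Lemma bang_nat p (x : H p m.+1) : bang_ n · W f · x = f · bang_ m · x.
Proof.
by apply: comp_tail2; have := padr_nat (i (sym_bang k)) f;
  rewrite ?(tens0f, tens2f).
Qed.
Lemma cup_nat p (x : H p m.+2) : cup_ n · W (W f) · x = f · cup_ m · x.
Proof.
by apply: comp_tail2; have := padr_nat (i (sym_cup k)) f;
  rewrite ?(tens0f, tens2f).
Qed.
Lemma cap_nat p (x : H p m) : cap_ n · f · x = W (W f) · cap_ m · x.
Proof.
by apply: comp_tail2; have := padr_nat (i (sym_cap k)) f;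
  rewrite ?(tens0f, tens2f).
Qed.
Lemma s_nat c p (x : H p m.+1) : s_ c n · W f · x = W f · s_ c m · x.
Proof.
by apply: comp_tail2; have := padr_nat (i (sym_s c)) f.
Qed.
Lemma swap_nat p (x : H p m.+2) : swap_ n · W (W f) · x = W (W f) · swap_ m · x.
Proof.
by apply: comp_tail2; have := padr_nat (pbraid C 1 1) f;
  rewrite ?(tens0f, tens2f).
Qed.
End Nat.

Lemma zetad_nat m n (f : H m n) p (x : H p m.+1) :
  zetad_ n · W f · x = f · zetad_ m · x.
Proof. by rewrite /zetad_ !compA zeta_nat cup_nat. Qed.
Lemma bangd_nat m n (f : H m n) p (x : H p m) :
  bangd_ n · f · x = W f · bangd_ m · x.
Proof. by rewrite /bangd_ !compA cap_nat bang_nat. Qed.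

Lemma swapK n p (x : H p n.+2) : swap_ n · swap_ n · x = x.
Proof.
rewrite -[RHS]comp1; apply: comp_tail.
by have := padr_comp (pbraid C 1 1) (pbraid C 1 1) n;
  rewrite (law_braidK (PROP_ax C) 1 1) padr_id.
Qed.

Lemma WswapK n p (x : H p n.+3) : W (swap_ n) · W (swap_ n) · x = x.
Proof.
rewrite -[RHS]comp1; apply: comp_tail; rewrite -W_comp -W_id; congr W.
by apply: eq_tail => *; rewrite comp1 compA swapK.
Qed.

Let braid_nat1 a b (g : H a b) :
  pbraid C b 1 · ptens g (pid C 1) = W g · pbraid C a 1.
Proof. by have := law_braid_nat (PROP_ax C) g (pid C 1). Qed.

Let braid01C : pbraid C 0 1 = pid C 1. Proof. exact: braid01. Qed.
Let braid21 n : padr (pbraid C 2 1) n = swap_ n.+1 · W (swap_ n).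
Proof.
have := law_Dbraid (PROP_ax C) 1 1 1.
rewrite (hcast_id (m := 3) (n := 3)) (hcast_id (m := 3) (n := 3)) => ->.
have -> := padr_comp (ptens (pbraid C 1 1) (pid C 1)) (W (pbraid C 1 1)) n.
by rewrite padrS (hcast_id (m := n.+3) (n := n.+3)) padr_W.
Qed.

Lemma swap_padr01 (g : H 0 1) n p (x : H p n.+1) :
  swap_ n · padr g n.+1 · x = W (padr g n) · x.
Proof.
apply: comp_tail; have := congr1 (fun f => padr f n) (braid_nat1 g).
by rewrite braid01C compf1 padr_comp (padrS g n)
  (hcast_id (m := n.+1) (n := n.+2)) padr_W.
Qed.
Lemma swap_Wpadr01 (g : H 0 1) n p (x : H p n.+1) :
  swap_ n · W (padr g n) · x = padr g n.+1 · x.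
Proof. by rewrite -swap_padr01 swapK. Qed.

Lemma Wpadr10_swap (g : H 1 0) n p (x : H p n.+2) :
  W (padr g n) · swap_ n · x = padr g n.+1 · x.
Proof.
apply: comp_tail; have := congr1 (fun f => padr f n) (braid_nat1 g).
rewrite braid01C comp1 padr_comp (padrS g n) (hcast_id (m := n.+2) (n := n.+1))
  padr_W.
by move=> ->.
Qed.
Lemma padr10_swap (g : H 1 0) n p (x : H p n.+2) :
  padr g n.+1 · swap_ n · x = W (padr g n) · x.
Proof. by rewrite -Wpadr10_swap swapK. Qed.

Lemma swap_s c n p (x : H p n.+2) :
  swap_ n · s_ c n.+1 · x = W (s_ c n) · swap_ n · x.
Proof.
apply: comp_tail2; have := congr1 (fun f => padr f n)
  (braid_nat1 (i (sym_s c))).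
by rewrite !padr_comp (padrS (i (sym_s c)) n)
  (hcast_id (m := n.+2) (n := n.+2)) padr_W.
Qed.
Lemma swap_Ws c n p (x : H p n.+2) :
  swap_ n · W (s_ c n) · x = s_ c n.+1 · swap_ n · x.
Proof. by rewrite -{1}[x]swapK -swap_s swapK. Qed.

Lemma swap_mu n p (x : H p n.+3) :
  swap_ n · mu_ n.+1 · x = W (mu_ n) · swap_ n.+1 · W (swap_ n) · x.
Proof.
rewrite -(compA (swap_ n.+1)).
apply: comp_tail2; have := congr1 (fun f => padr f n)
  (braid_nat1 (i (sym_mu k))).
by rewrite !padr_comp (padrS (i (sym_mu k)) n)
  (hcast_id (m := n.+3) (n := n.+2)) padr_W braid21.
Qed.
Lemma swap_Wmu n p (x : H p n.+3) :
  swap_ n · W (mu_ n) · x = mu_ n.+1 · W (swap_ n) · swap_ n.+1 · x.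
Proof.
by rewrite -(swapK (mu_ n.+1 · _)) swap_mu WswapK swapK.
Qed.

Lemma swap_swap n p (x : H p n.+3) :
  swap_ n.+1 · W (swap_ n) · swap_ n.+1 · x =
  W (swap_ n) · swap_ n.+1 · W (swap_ n) · x.
Proof.
rewrite -!(compA (swap_ n.+1) (W _)).
apply: comp_tail2; have := congr1 (fun f => padr f n)
  (braid_nat1 (pbraid C 1 1)).
by rewrite !padr_comp (padrS (pbraid C 1 1) n)
  (hcast_id (m := n.+3) (n := n.+3)) padr_W braid21.
Qed.

Lemma delta_swap n p (x : H p n.+2) :
  swap_ n.+1 · W (swap_ n) · delta_ n.+1 · x = W (delta_ n) · swap_ n · x.
Proof.
rewrite -!(compA (swap_ n.+1) (W _)).
apply: comp_tail2; have := congr1 (fun f => padr f n)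
  (braid_nat1 (i (sym_Delta k))).
by rewrite !padr_comp (padrS (i (sym_Delta k)) n)
  (hcast_id (m := n.+2) (n := n.+3)) padr_W braid21.
Qed.

(** From here on the equations of the presentation are assumed to hold for
    the chosen morphisms of C. *)
Hypothesis Ei :
  forall m n t t', @FR_equations k m n t t' -> eval i t = eval i t'.

Local Notation L := (PROP_ax C).

Lemma mu_zeta n p (x : H p n.+1) : mu_ n · zeta_ n.+1 · x = x.
Proof.
rewrite -[RHS]comp1; apply: comp_tail.
have := congr1 (fun f => padr f n) (Ei (eqn01 k)).
by rewrite /= padr_comp (padrS (i (sym_zeta k)) n)
  (hcast_id (m := n.+1) (n := n.+2)) padr_id.
Qed.
Lemma mu_assoc n p (x : H p n.+3) :
  mu_ n · W (mu_ n) · x = mu_ n · mu_ n.+1 · x.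
Proof.
apply: comp_tail2.
have := congr1 (fun f => padr f n) (Ei (eqn02 k)).
by rewrite /= !padr_comp (padrS (i (sym_mu k)) n)
  (hcast_id (m := n.+3) (n := n.+2)) padr_W.
Qed.
Lemma mu_swap n p (x : H p n.+2) : mu_ n · swap_ n · x = mu_ n · x.
Proof.
apply: comp_tail.
have := congr1 (fun f => padr f n) (Ei (eqn03 k)).
by rewrite /= !padr_comp.
Qed.
Lemma bang_delta n p (x : H p n.+1) : bang_ n.+1 · delta_ n · x = x.
Proof.
rewrite -[RHS]comp1; apply: comp_tail.
have := congr1 (fun f => padr f n) (Ei (eqn04 k)).
by rewrite /= !padr_comp (padrS (i (sym_bang k)) n)
  (hcast_id (m := n.+2) (n := n.+1)) padr_id.
Qed.
Lemma delta_assoc n p (x : H p n.+1) :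
  W (delta_ n) · delta_ n · x = delta_ n.+1 · delta_ n · x.
Proof.
apply: comp_tail2.
have := congr1 (fun f => padr f n) (Ei (eqn05 k)).
by rewrite /= !padr_comp (padrS (i (sym_Delta k)) n)
  (hcast_id (m := n.+2) (n := n.+3)) padr_W.
Qed.
Lemma swap_delta n p (x : H p n.+1) : swap_ n · delta_ n · x = delta_ n · x.
Proof.
apply: comp_tail.
have := congr1 (fun f => padr f n) (Ei (eqn06 k)).
by rewrite /= !padr_comp.
Qed.
Lemma delta_mu n p (x : H p n.+2) : delta_ n · mu_ n · x =
  mu_ n.+1 · W (W (mu_ n)) · W (swap_ n.+1) · delta_ n.+2 · W (delta_ n) · x.
Proof.
suff E : delta_ n · mu_ n =
  mu_ n.+1 · W (W (mu_ n)) · W (swap_ n.+1) · delta_ n.+2 · W (delta_ n).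
  by rewrite (comp_tail x E) !compA.
have := congr1 (fun f => padr f n) (Ei (eqn07 k)).
rewrite /= !padr_comp => ->.
rewrite (tens_padr (i (sym_mu k))) (tens_padr (i (sym_Delta k))).
rewrite !padr_comp tens2f !padr_W (padrS (W (pbraid C 1 1)) n).
rewrite (hcast_id (m := n.+4) (n := n.+4)) padr_W !compA.
have eL a b (f : H a b) :
  padr (padr f 1) n = hcast (addnA a 1 n) (addnA b 1 n) (padr f n.+1).
  by rewrite -padrS.
have eL2 a b (f : H a b) :
  padr (padr f 2) n = hcast (addnA a 2 n) (addnA b 2 n) (padr f n.+2).
  rewrite /padr -(law_tensA L f (pid C 2) (pid C n)).
  by congr (hcast _ _ (ptens f _)); apply: (tens11 _ 2 n).
rewrite (eL _ _ (i (sym_mu k))) (eL2 _ _ (i (sym_Delta k)))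
  (hcast_id (m := n.+3) (n := n.+2)).
by rewrite (hcast_id (m := n.+3) (n := n.+4)).
Qed.
Lemma delta_zeta n p (x : H p n) :
  delta_ n · zeta_ n · x = zeta_ n.+1 · zeta_ n · x.
Proof.
apply: comp_tail2.
have := congr1 (fun f => padr f n) (Ei (eqn08 k)).
rewrite /= tens_padr !padr_comp => ->.
by rewrite (tens0f (i (sym_zeta k))) (padrS (i (sym_zeta k)) n)
 (hcast_id (m := n.+1) (n := n.+2)).
Qed.
Lemma bang_mu n p (x : H p n.+2) :
  bang_ n · mu_ n · x = bang_ n · bang_ n.+1 · x.
Proof.
apply: comp_tail2.
have := congr1 (fun f => padr f n) (Ei (eqn09 k)).
rewrite /= tens_padr' !padr_comp => ->.
by rewrite (tens0f (i (sym_bang k))) (padrS (i (sym_bang k)) n)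
 (hcast_id (m := n.+2) (n := n.+1)).
Qed.
Lemma bang_zeta n p (x : H p n) : bang_ n · zeta_ n · x = x.
Proof.
rewrite -[RHS]comp1; apply: comp_tail.
have := congr1 (fun f => padr f n) (Ei (eqn10 k)).
by rewrite /= !padr_comp padr_id.
Qed.
Lemma s_mul b c n p (x : H p n.+1) : s_ (b * c)%R n · x = s_ b n · s_ c n · x.
Proof.
rewrite -(compA (s_ b n)); congr (_ · _).
have := congr1 (fun f => padr f n) (Ei (eqn11 b c)).
by rewrite /= !padr_comp.
Qed.
Lemma s_add b c n p (x : H p n.+1) : s_ (b + c)%R n · x =
  mu_ n · s_ b n.+1 · W (s_ c n) · delta_ n · x.
Proof.
suff E : s_ (b + c)%R n = mu_ n · s_ b n.+1 · W (s_ c n) · delta_ n.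
  by rewrite E !compA.
have := congr1 (fun f => padr f n) (Ei (eqn12 b c)).
rewrite /= !padr_comp tens_padr padr_comp (padrS (i (sym_s b)) n).
by rewrite (hcast_id (m := n.+2) (n := n.+2)) padr_W !compA.
Qed.
Lemma s_1 n p (x : H p n.+1) : s_ 1%R n · x = x.
Proof.
rewrite -[RHS]comp1; congr (_ · _).
by have := congr1 (fun f => padr f n) (Ei (eqn13 k)); rewrite /= padr_id.
Qed.
Lemma s_0 n p (x : H p n.+1) : s_ 0%R n · x = zeta_ n · bang_ n · x.
Proof.
rewrite -(compA (zeta_ n)); congr (_ · _).
by have := congr1 (fun f => padr f n) (Ei (eqn14 k)); rewrite /= padr_comp.
Qed.
Lemma mu_s c n p (x : H p n.+2) :
  mu_ n · s_ c n.+1 · W (s_ c n) · x = s_ c n · mu_ n · x.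
Proof.
rewrite -(compA (s_ _ _) (W _)); apply: comp_tail2.
have := congr1 (fun f => padr f n) (Ei (eqn15 c)).
rewrite /= !padr_comp tens_padr padr_comp (padrS (i (sym_s c)) n).
by rewrite (hcast_id (m := n.+2) (n := n.+2)) padr_W.
Qed.
Lemma s_zeta c n p (x : H p n) : s_ c n · zeta_ n · x = zeta_ n · x.
Proof.
apply: comp_tail.
by have := congr1 (fun f => padr f n) (Ei (eqn16 c)); rewrite /= !padr_comp.
Qed.
Lemma delta_s c n p (x : H p n.+1) :
  delta_ n · s_ c n · x = s_ c n.+1 · W (s_ c n) · delta_ n · x.
Proof.
rewrite -(compA (s_ _ _) (W _)); apply: comp_tail2; apply: esym.
have := congr1 (fun f => padr f n) (Ei (eqn17 c)).
rewrite /= !padr_comp tens_padr padr_comp (padrS (i (sym_s c)) n).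
by rewrite (hcast_id (m := n.+2) (n := n.+2)) padr_W.
Qed.
Lemma bang_s c n p (x : H p n.+1) : bang_ n · s_ c n · x = bang_ n · x.
Proof.
apply: comp_tail.
by have := congr1 (fun f => padr f n) (Ei (eqn18 c)); rewrite /= !padr_comp.
Qed.
Lemma zigzag n p (x : H p n.+1) : cup_ n.+1 · W (cap_ n) · x = x.
Proof.
rewrite -[RHS]comp1; apply: comp_tail.
have := congr1 (fun f => padr f n) (Ei (eqn19 k)).
rewrite /= !padr_comp (padrS (i (sym_cup k)) n).
by rewrite (hcast_id (m := n.+3) (n := n.+1)) padr_W padr_id.
Qed.
Lemma zagzig n p (x : H p n.+1) : W (cup_ n) · cap_ n.+1 · x = x.
Proof.
rewrite -[RHS]comp1; apply: comp_tail; apply: esym.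
have := congr1 (fun f => padr f n) (Ei (eqn20 k)).
rewrite /= !padr_comp (padrS (i (sym_cap k)) n).
by rewrite (hcast_id (m := n.+1) (n := n.+3)) padr_W padr_id.
Qed.
Lemma padr_zetad n : padr (eval i (zeta_dag k)) n = zetad_ n.
Proof.
by rewrite /= padr_comp (padrS (i (sym_zeta k)) n)
  (hcast_id (m := n.+1) (n := n.+2)).
Qed.
Lemma padr_bangd n : padr (eval i (bang_dag k)) n = bangd_ n.
Proof.
by rewrite /= padr_comp (padrS (i (sym_bang k)) n)
  (hcast_id (m := n.+2) (n := n.+1)).
Qed.
Lemma zetad_zeta n p (x : H p n) : zetad_ n · zeta_ n · x = x.
Proof.
rewrite -[RHS]comp1; apply: comp_tail.
have E : eval i (zeta_dag k) · i (sym_zeta k) = pid C 0 := Ei (eqn26 k).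
by have := congr1 (fun f => padr f n) E; rewrite padr_comp (padr_zetad n)
  padr_id.
Qed.
Lemma bang_bangd n p (x : H p n) : bang_ n · bangd_ n · x = x.
Proof.
rewrite -[RHS]comp1; apply: comp_tail.
have E : i (sym_bang k) · eval i (bang_dag k) = pid C 0 := Ei (eqn28 k).
by have := congr1 (fun f => padr f n) E; rewrite padr_comp (padr_bangd n)
  padr_id.
Qed.
Lemma cup_zetad n p (x : H p n.+2) :
  cup_ n · s_ (-1)%R n.+1 · x = zetad_ n · mu_ n · x.
Proof.
apply: comp_tail2.
have E : i (sym_cup k) · ptens (i (sym_s (-1)%R)) (pid C 1) =
  eval i (zeta_dag k) · i (sym_mu k) := Ei (eqn29 k).
have := congr1 (fun f => padr f n) E.
rewrite padr_comp (padr_comp _ (i (sym_mu k))) (padr_zetad n).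
by rewrite (padrS (i (sym_s _)) n) (hcast_id (m := n.+2) (n := n.+2)).
Qed.
Lemma cap_bangd n p (x : H p n) : cap_ n · x = delta_ n · bangd_ n · x.
Proof.
rewrite -(compA (delta_ n)); congr (_ · _).
have E : i (sym_cap k) = i (sym_Delta k) · eval i (bang_dag k) := Ei (eqn30 k).
by have := congr1 (fun f => padr f n) E; rewrite padr_comp (padr_bangd n).
Qed.
Lemma s_inv c n p (x : H p n.+1) : c != 0%R ->
  s_ c^-1%R n · x = cup_ n.+1 · W (s_ c n.+1) · W (cap_ n) · x.
Proof.
move=> c0.
suff E : s_ c^-1%R n = cup_ n.+1 · W (s_ c n.+1) · W (cap_ n).
  by rewrite E !compA.
have := congr1 (fun f => padr f n) (Ei (eqn31 c0)).
rewrite /= !padr_comp (padrS (i (sym_cup k)) n) (padrS (W (i (sym_s c))) n).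
rewrite (hcast_id (m := n.+3) (n := n.+1)) (hcast_id (m := n.+3) (n := n.+3)).
by rewrite !padr_W !compA.
Qed.

(** * Consequences of the equations for ζ† and !† *)

(** Two-layer rewrite rules remain valid under an extra wire on the left. *)
Section Under.
Variables (m n p q : nat).
Lemma W_cancel (g : H n m) (f : H m n) :
  (forall p (x : H p m), g · f · x = x) ->
  forall p (x : H p m.+1), W g · W f · x = x.
Proof.
move=> e p' x; rewrite -compA -W_comp -[RHS]comp1 -W_id; congr (W _ · _).
by apply: eq_tail => *; rewrite compA e comp1.
Qed.
Lemma W_fuse (g : H n q) (f : H m n) (h : H m q) :
  (forall p (x : H p m), g · f · x = h · x) ->
  forall p (x : H p m.+1), W g · W f · x = W h · x.
Proof.
move=> e p' x; rewrite -compA -W_comp; congr (W _ · _).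
by apply: eq_tail => *; rewrite compA e.
Qed.
Lemma W_square (g : H n q) (f : H m n) (g' : H p q) (f' : H m p) :
  (forall p (x : H p m), g · f · x = g' · f' · x) ->
  forall p (x : H p m.+1), W g · W f · x = W g' · W f' · x.
Proof.
move=> e p' x; rewrite -!compA -!W_comp; congr (W _ · _).
by apply: eq_tail => *; rewrite !compA e.
Qed.
End Under.

Lemma Wzetad_swap n p (x : H p n.+2) :
  W (zetad_ n) · swap_ n · x = zetad_ n.+1 · x.
Proof. by rewrite -!padr_zetad Wpadr10_swap. Qed.
Lemma swap_bangd n p (x : H p n.+1) :
  swap_ n · bangd_ n.+1 · x = W (bangd_ n) · x.
Proof. by rewrite -!padr_bangd swap_padr01. Qed.
Lemma swap_Wbangd n p (x : H p n.+1) :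
  swap_ n · W (bangd_ n) · x = bangd_ n.+1 · x.
Proof. by rewrite -!padr_bangd swap_Wpadr01. Qed.
Lemma zetad_swap n p (x : H p n.+2) :
  zetad_ n.+1 · swap_ n · x = W (zetad_ n) · x.
Proof. by rewrite -!padr_zetad padr10_swap. Qed.

Lemma Wbang_swap n p (x : H p n.+2) :
  W (bang_ n) · swap_ n · x = bang_ n.+1 · x.
Proof. exact: Wpadr10_swap. Qed.
Lemma bang_swap n p (x : H p n.+2) : bang_ n.+1 · swap_ n · x = W (bang_ n) · x.
Proof. exact: padr10_swap. Qed.
Lemma swap_zeta n p (x : H p n.+1) : swap_ n · zeta_ n.+1 · x = W (zeta_ n) · x.
Proof. exact: swap_padr01. Qed.
Lemma swap_Wzeta n p (x : H p n.+1) :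
  swap_ n · W (zeta_ n) · x = zeta_ n.+1 · x.
Proof. exact: swap_Wpadr01. Qed.
Lemma mu_Wzeta n p (x : H p n.+1) : mu_ n · W (zeta_ n) · x = x.
Proof. by rewrite -swap_padr01 mu_swap mu_zeta. Qed.
Lemma Wbang_delta n p (x : H p n.+1) : W (bang_ n) · delta_ n · x = x.
Proof. by rewrite -swap_delta Wpadr10_swap bang_delta. Qed.

(** Scalars turn into their inverses when they slide around a cap: the
    transpose of s_c is s_(c^-1). *)
Lemma Ws_cap c n p (x : H p n) : c != 0%R ->
  W (s_ c^-1%R n) · cap_ n · x = s_ c n.+1 · cap_ n · x.
Proof.
move=> c0.
have -> : s_ c^-1%R n = cup_ n.+1 · W (s_ c n.+1) · W (cap_ n).
  by apply: eq_tail => *; rewrite s_inv // !compA.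
by rewrite !W_comp !compA -!cap_nat zagzig.
Qed.

Lemma sK c n p (x : H p n.+1) : c != 0%R -> s_ c^-1%R n · s_ c n · x = x.
Proof. by move=> c0; rewrite -s_mul mulVf // s_1. Qed.

Lemma s_bangd c n p (x : H p n) :
  c != 0%R -> s_ c n · bangd_ n · x = bangd_ n · x.
Proof.
move=> c0; rewrite /bangd_ !compA -bang_nat -{1}[c]invrK Ws_cap ?invr_eq0 //.
by rewrite bang_s.
Qed.

Lemma cup_bangd n p (x : H p n.+1) : cup_ n · bangd_ n.+1 · x = bang_ n · x.
Proof. by rewrite /bangd_ compA -bang_nat zagzig. Qed.

Lemma zetad_cap n p (x : H p n) : zetad_ n.+1 · cap_ n · x = zeta_ n · x.
Proof. by rewrite /zetad_ compA zeta_nat zigzag. Qed.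

(** A morphism 1 -> 0 is determined by its composite with a cap, and ζ† turns
    a cap into ζ, which is fixed by scalars. *)
Lemma zetad_s c n p (x : H p n.+1) :
  c != 0%R -> zetad_ n · s_ c n · x = zetad_ n · x.
Proof.
move=> c0; rewrite -[x]zagzig s_nat !zetad_nat -Ws_cap // zetad_nat zetad_cap.
by rewrite s_zeta.
Qed.

Lemma zetad_bangd n p (x : H p n) : zetad_ n · bangd_ n · x = x.
Proof.
have -> : bangd_ n · x = W (bang_ n) · cap_ n · x.
  by rewrite cap_bangd Wbang_delta.
by rewrite zetad_nat zetad_cap bang_zeta.
Qed.

(** If one of two copies of x is zero, so is the other.  Both sides agree after
    composition with a cap, where this becomes Δ ∘ ζ = ζ ⊕ ζ. *)
Lemma Wzetad_delta n p (x : H p n.+1) :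
  W (zetad_ n) · delta_ n · x = zeta_ n · zetad_ n · x.
Proof.
rewrite -swap_delta Wzetad_swap.
rewrite -[x]zagzig delta_nat !zetad_nat zeta_nat; congr (_ · _).
rewrite zetad_cap cap_bangd -delta_assoc zetad_nat -cap_bangd zetad_cap.
by rewrite delta_zeta.
Qed.

Lemma s_inj c n p (x y : H p n.+1) : c != 0%R ->
  s_ c n · x = s_ c n · y -> x = y.
Proof. by move=> c0 e; rewrite -[x](sK _ c0) e sK. Qed.

(** Adding an unconstrained value gives an unconstrained value.  This is the
    dual of [Wzetad_delta], with cups in place of caps: the scalar -1 turns a
    cup into ζ† ∘ μ, where the associativity of μ applies. *)
Lemma mu_bangd n p (x : H p n.+1) :
  mu_ n · bangd_ n.+1 · x = bangd_ n · bang_ n · x.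
Proof.
have n10 : (-1)%R != 0%R :> k by rewrite oppr_eq0 oner_eq0.
apply: (s_inj n10).
rewrite -[LHS]zigzag -[RHS]zigzag -!s_nat -!mu_nat -!bangd_nat.
rewrite -(bang_nat (cap_ n)) !cup_zetad -mu_assoc -bangd_nat -cup_zetad s_bangd
  // cup_bangd.
by rewrite bang_mu -cup_zetad s_bangd // cup_bangd.
Qed.

(** * Shears *)

(** f acts on its first wire, the control, and on the wires from the third on;
    the second wire passes by. *)
Definition bypass m n (f : H m.+1 n.+1) : H m.+2 n.+2 :=
  swap_ n · W f · swap_ m.

Lemma bypassE m n (f : H m.+1 n.+1) p (x : H p m.+2) :
  bypass f · x = swap_ n · W f · swap_ m · x.
Proof. by rewrite /bypass !compA. Qed.

Lemma Wbypass m n (f : H m.+1 n.+1) p (x : H p m.+3) :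
  W (bypass f) · x = W (swap_ n) · W (W f) · W (swap_ m) · x.
Proof. by rewrite /bypass !W_comp !compA. Qed.

Lemma bypass_nat m n (f : H m n) p (x : H p m.+2) :
  bypass (W f) · x = W (W f) · x.
Proof. by rewrite /bypass !compA swap_nat swapK. Qed.

Lemma bypass_comp m n q (g : H n.+1 q.+1) (f : H m.+1 n.+1) p (x : H p m.+2) :
  bypass (g · f) · x = bypass g · bypass f · x.
Proof. by rewrite /bypass !W_comp !compA swapK. Qed.

Lemma swap_delta_swap n p (x : H p n.+2) :
  delta_ n.+1 · swap_ n · x = W (swap_ n) · swap_ n.+1 · W (delta_ n) · x.
Proof. by rewrite -{2}[x]swapK -delta_swap swapK WswapK. Qed.

Section BypassNat.
Variables (m n : nat) (f : H m.+1 n.+1) (p : nat).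
Implicit Type x : H p m.+1.

Lemma zeta_bypass x : W (zeta_ n) · f · x = bypass f · W (zeta_ m) · x.
Proof. by rewrite /bypass !compA swap_Wzeta -zeta_nat swap_zeta. Qed.
Lemma bangd_bypass x : W (bangd_ n) · f · x = bypass f · W (bangd_ m) · x.
Proof. by rewrite /bypass !compA swap_Wbangd -bangd_nat swap_bangd. Qed.
Lemma bang_bypass (x : H p m.+2) :
  W (bang_ n) · bypass f · x = f · W (bang_ m) · x.
Proof. by rewrite /bypass !compA Wbang_swap bang_nat bang_swap. Qed.
Lemma zetad_bypass (x : H p m.+2) :
  W (zetad_ n) · bypass f · x = f · W (zetad_ m) · x.
Proof. by rewrite /bypass !compA Wzetad_swap zetad_nat zetad_swap. Qed.
Lemma s_bypass c (x : H p m.+2) :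
  W (s_ c n) · bypass f · x = bypass f · W (s_ c m) · x.
Proof. by rewrite /bypass !compA -swap_s s_nat -swap_Ws. Qed.
Lemma mu_bypass (x : H p m.+3) :
  W (mu_ n) · bypass (bypass f) · x = bypass f · W (mu_ m) · x.
Proof.
by rewrite {1 3}/bypass !compA Wbypass -swap_mu mu_nat -swap_Wmu.
Qed.
Lemma delta_bypass (x : H p m.+2) :
  W (delta_ n) · bypass f · x = bypass (bypass f) · W (delta_ m) · x.
Proof.
rewrite {1 2}/bypass !compA Wbypass -delta_swap delta_nat.
by rewrite swap_delta_swap.
Qed.
Lemma swap_bypass (x : H p m.+3) :
  W (swap_ n) · bypass (bypass f) · x = bypass (bypass f) · W (swap_ m) · x.
Proof.
rewrite {1 3}/bypass !compA !Wbypass -swap_swap swap_nat.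
by rewrite swap_swap.
Qed.
End BypassNat.

(** f does not change its control wire: copying the control before or after f
    makes no difference. *)
Definition copies_control m n (f : H m.+1 n.+1) :=
  forall p (x : H p m.+1), delta_ n · f · x = W f · delta_ m · x.

Lemma copies_control_bypass m n (f : H m.+1 n.+1) :
  copies_control f -> copies_control (bypass f).
Proof.
move=> cf p x; rewrite Wbypass {1}/bypass !compA swap_delta_swap.
have -> : delta_ m.+1 · x =
  W (swap_ m) · swap_ m.+1 · W (delta_ m) · swap_ m · x.
  by rewrite -swap_delta_swap swapK.
by rewrite (W_square cf) swap_nat WswapK.
Qed.

Lemma copies_control_bypass2 m n (f : H m.+1 n.+1) p (x : H p m.+2) :
  copies_control f ->
  delta_ n.+1 · bypass f · x = bypass (bypass f) · delta_ m.+1 · x.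
Proof.
move=> /copies_control_bypass cf; rewrite -[LHS]swap_delta cf
  -[X in _ = _ · X]swap_delta.
by rewrite [bypass (bypass f)]/bypass !compA swapK.
Qed.

(** The map (x, y) |-> (x, c x + y) on the first two wires. *)
Definition shear1 c n : H n.+2 n.+2 :=
  W (mu_ n) · W (s_ c n.+1) · delta_ n.+1.
Lemma shear1E c n p (x : H p n.+2) :
  shear1 c n · x = W (mu_ n) · W (s_ c n.+1) · delta_ n.+1 · x.
Proof. by rewrite /shear1 !compA. Qed.

Lemma shear1_nat c m n (f : H m n) p (x : H p m.+2) :
  shear1 c n · W (W f) · x = W (W f) · shear1 c m · x.
Proof.
by rewrite !shear1E delta_nat (W_square (s_nat _ _)) (W_square (mu_nat _)).
Qed.

(** Actions of one control on different wires commute, since the copies of the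
    control are interchangeable. *)
Lemma shear1_bypass c m n (f : H m.+1 n.+1) p (x : H p m.+2) :
  copies_control f ->
  shear1 c n · bypass f · x = bypass f · shear1 c m · x.
Proof.
by move=> cf; rewrite !shear1E copies_control_bypass2 // s_bypass mu_bypass.
Qed.

Lemma bang_shear1 c n p (x : H p n.+2) :
  W (bang_ n) · shear1 c n · x = W (bang_ n) · x.
Proof.
by rewrite shear1E (W_square (@bang_mu n)) (W_fuse (@bang_s c n.+1))
  Wbang_delta.
Qed.

Lemma shear1_Wzeta c n p (x : H p n.+1) :
  shear1 c n · W (zeta_ n) · x = W (s_ c n) · delta_ n · x.
Proof.
by rewrite shear1E delta_nat (W_square (s_nat _ _)) (W_cancel (@mu_Wzeta n)).
Qed.

Lemma shear1_zeta c n p (x : H p n.+1) :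
  shear1 c n · zeta_ n.+1 · x = zeta_ n.+1 · x.
Proof.
by rewrite shear1E delta_zeta -!zeta_nat s_zeta mu_zeta.
Qed.

Lemma shear1_0 n p (x : H p n.+2) : shear1 0%R n · x = x.
Proof.
have e : s_ 0%R n.+1 = zeta_ n.+1 · bang_ n.+1.
  by apply: eq_tail => *; rewrite s_0 compA.
by rewrite shear1E e W_comp compA (W_cancel (@mu_zeta n)) Wbang_delta.
Qed.

Lemma shear1_add c d n p (x : H p n.+2) :
  shear1 (c + d)%R n · x = shear1 c n · shear1 d n · x.
Proof.
have e : s_ (c + d)%R n.+1 = mu_ n.+1 · s_ c n.+2 · W (s_ d n.+1) · delta_ n.+1.
  by apply: eq_tail => *; rewrite s_add !compA.
rewrite !shear1E !delta_nat (W_square (s_nat _ _)) (W_square (@mu_assoc n)).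
rewrite (W_square (s_nat _ _)) -delta_assoc e !W_comp !compA.
by rewrite (W_square (s_nat _ _)).
Qed.

Lemma shear1_s c d n p (x : H p n.+2) :
  W (s_ d n) · shear1 c n · x = shear1 (d * c)%R n · W (s_ d n) · x.
Proof.
have e : s_ (d * c)%R n.+1 = s_ d n.+1 · s_ c n.+1.
  by apply: eq_tail => *; rewrite s_mul compA.
have e2 : s_ d n · mu_ n = mu_ n · s_ d n.+1 · W (s_ d n).
  by apply: eq_tail => *; rewrite !compA mu_s.
rewrite !shear1E delta_nat e W_comp -(compA (W (s_ d n))) -W_comp e2.
by rewrite !W_comp !compA -!(W_square (s_nat _ _)).
Qed.

Lemma s_shear1 c d n p (x : H p n.+2) :
  s_ c n.+1 · shear1 (c * d)%R n · x = shear1 d n · s_ c n.+1 · x.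
Proof.
have e : s_ (c * d)%R n.+1 = s_ d n.+1 · s_ c n.+1.
  by apply: eq_tail => *; rewrite mulrC s_mul compA.
by rewrite !shear1E e W_comp delta_s !s_nat !compA !s_nat.
Qed.

Lemma shear1_mu c n p (x : H p n.+3) :
  W (mu_ n) · shear1 c n.+1 · x = shear1 c n · W (mu_ n) · x.
Proof.
by rewrite !shear1E delta_nat (W_square (s_nat _ _)) -(W_square (@mu_assoc n)).
Qed.

Lemma bypass_shear1E c n p (x : H p n.+3) : bypass (shear1 c n) · x =
  W (W (mu_ n)) · W (W (s_ c n.+1)) · W (swap_ n.+1) · delta_ n.+2 · x.
Proof.
rewrite /shear1 !bypass_comp !bypass_nat /bypass !compA -delta_swap.
by rewrite swapK.
Qed.

Lemma swap_shear1 c n p (x : H p n.+3) :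
  W (swap_ n) · bypass (shear1 c n) · x = shear1 c n.+1 · W (swap_ n) · x.
Proof.
rewrite bypass_shear1E !shear1E delta_nat (W_square (s_nat _ _)).
have e : swap_ n · W (mu_ n) = mu_ n.+1 · W (swap_ n) · swap_ n.+1.
  by apply: eq_tail => *; rewrite !compA swap_Wmu.
rewrite -(compA (W (swap_ n))) -W_comp e !W_comp !compA.
by rewrite (W_square (@swap_Ws c n.+1)) WswapK.
Qed.

Lemma bypass_shear1 c n p (x : H p n.+3) :
  bypass (shear1 c n) · x = W (swap_ n) · shear1 c n.+1 · W (swap_ n) · x.
Proof. by rewrite -swap_shear1 WswapK. Qed.

Lemma shear1_mu2 c n p (x : H p n.+3) :
  W (mu_ n) · bypass (shear1 c n) · x = shear1 c n · W (mu_ n) · x.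
Proof.
by rewrite bypass_shear1 (W_fuse (@mu_swap n)) shear1_mu (W_fuse (@mu_swap n)).
Qed.

(** Copying y + c x amounts to copying y and adding c x to each copy; this is
    the only use of the bialgebra law for Δ ∘ μ.  The morphism gam below is
    x |-> (x, c x), and both sides reduce to gam applied twice. *)
Lemma shear1_delta c n p (x : H p n.+2) :
  W (delta_ n) · shear1 c n · x =
  bypass (shear1 c n) · shear1 c n.+1 · W (delta_ n) · x.
Proof.
have [gam gE] : exists gam : forall m, H m.+1 m.+2,
    forall m q (y : H q m.+1), W (s_ c m) · delta_ m · y = gam m · y.
  by exists (fun m => W (s_ c m) · delta_ m) => *; rewrite compA.
have gnat m m' (f : H m m') q (y : H q m.+1) :
    gam m' · W f · y = W (W f) · gam m · y.
  by rewrite -!gE delta_nat (W_square (s_nat _ _)).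
have dg m q (y : H q m.+1) : W (delta_ m) · gam m · y = gam m.+1 · gam m · y.
  have e : delta_ m · s_ c m = s_ c m.+1 · W (s_ c m) · delta_ m.
    by apply: eq_tail => *; rewrite !compA delta_s.
  rewrite -!gE -(compA (W (delta_ m))) -W_comp e !W_comp !compA.
  by rewrite delta_assoc delta_nat.
have sg m q (y : H q m.+1) :
    W (swap_ m) · gam m.+1 · gam m · y = gam m.+1 · gam m · y.
  by rewrite -!dg (W_fuse (@swap_delta m)).
have e1 : delta_ n · mu_ n =
   mu_ n.+1 · W (W (mu_ n)) · W (swap_ n.+1) · W (W (delta_ n)) · delta_ n.+1.
  by apply: eq_tail => *; rewrite !compA delta_mu delta_nat.
have e2 : swap_ n · mu_ n.+1 · W (swap_ n) · W (mu_ n.+1) · swap_ n.+2 =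
   mu_ n.+1 · W (W (mu_ n)) · W (swap_ n.+1).
  apply: eq_tail => *; rewrite !compA swap_mu WswapK swap_Wmu swapK.
  by rewrite mu_nat.
rewrite bypass_shear1 !shear1E !gE -(compA (W (delta_ n))) -W_comp e1 !W_comp.
rewrite !compA dg !gnat -[gam n.+2 · _ in RHS]sg -(W_square (swap_nat _)).
have := congr1 (@W _ _ _) e2; rewrite !W_comp => e3.
have := congr1 (fun f => f · W (W (W (delta_ n))) · gam n.+2 · gam n.+1 · x) e3.
by rewrite !compA => ->.
Qed.

(** * Vectors and the shear by a vector *)

Definition hd n (v : 'rV[k]_n.+1) : k := v 0%R 0%R.
Definition tl n (v : 'rV[k]_n.+1) : 'rV[k]_n :=
  rsubmx (v : 'M_(1, 1 + n)).
Definition consv n (c : k) (v : 'rV[k]_n) : 'rV[k]_n.+1 :=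
  row_mx (c%:M : 'rV_1) v.

Lemma hd_cons n c (v : 'rV_n) : hd (consv c v) = c.
Proof.
have e : (c%:M : 'rV_1)%R 0%R 0%R = c by rewrite mxE eqxx.
rewrite /hd /consv -{2}e -(row_mxEl (c%:M : 'rV_1)%R v).
by congr (fun_of_matrix _ _ _); apply: val_inj.
Qed.
Lemma tl_cons n c (v : 'rV_n) : tl (consv c v) = v.
Proof. exact: row_mxKr. Qed.
Lemma cons_hdtl n (v : 'rV_n.+1) : consv (hd v) (tl v) = v.
Proof.
have e : lsubmx (v : 'M_(1, 1 + n)) = ((hd v)%:M : 'rV_1)%R.
  apply/rowP => j; rewrite !mxE /hd !ord1 eqxx mulr1n.
  by congr (fun_of_matrix v _ _); apply: val_inj.
by rewrite /consv -e; apply: (hsubmxK (v : 'M_(1, 1 + n))).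
Qed.
Lemma hdD n (u v : 'rV_n.+1) : hd (u + v)%R = (hd u + hd v)%R.
Proof. by rewrite /hd mxE. Qed.
Lemma tlD n (u v : 'rV_n.+1) : tl (u + v)%R = (tl u + tl v)%R.
Proof. exact: linearD. Qed.
Lemma hdZ n c (u : 'rV_n.+1) : hd (c *: u)%R = (c * hd u)%R.
Proof. by rewrite /hd mxE. Qed.
Lemma tlZ n c (u : 'rV_n.+1) : tl (c *: u)%R = (c *: tl u)%R.
Proof. exact: linearZ. Qed.
Lemma hd0 n : @hd n 0%R = 0%R.
Proof. by rewrite /hd mxE. Qed.
Lemma tl0 n : @tl n 0%R = 0%R.
Proof. exact: linear0. Qed.
Definition hdtlE := (hd_cons, tl_cons, hdD, tlD, hdZ, tlZ, hd0, tl0).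
Lemma row_eq n (u v : 'rV_n.+1) : hd u = hd v -> tl u = tl v -> u = v.
Proof. by move=> eh et; rewrite -[u]cons_hdtl eh et cons_hdtl. Qed.

(** (x, y) |-> (x, y + x v), coordinate by coordinate. *)
Fixpoint shear n : 'rV[k]_n -> H n.+1 n.+1 :=
  match n return 'rV[k]_n -> H n.+1 n.+1 with
  | 0 => fun=> pid C 1
  | n'.+1 => fun v => bypass (shear (tl v)) · shear1 (hd v) n'
  end.

Lemma shearS n (v : 'rV_n.+1) p (x : H p n.+2) :
  shear v · x = bypass (shear (tl v)) · shear1 (hd v) n · x.
Proof. exact: compA. Qed.

Lemma shear_nil (v : 'rV_0) p (x : H p 1) : shear v · x = x.
Proof. exact: comp1. Qed.

Lemma bypass_eq m n (f g : H m.+1 n.+1) :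
  (forall p (x : H p m.+1), f · x = g · x) -> bypass f = bypass g.
Proof. by move=> /eq_tail ->. Qed.

Lemma bypass_id n p (x : H p n.+2) : bypass (pid C n.+1) · x = x.
Proof. by rewrite !bypassE W_id comp1 swapK. Qed.

Lemma copies_control_shear1 c n : copies_control (shear1 c n).
Proof.
move=> p x; rewrite shear1E !delta_nat -delta_assoc.
by rewrite /shear1 !W_comp !compA.
Qed.

Lemma shear_copies_control n (v : 'rV_n) : copies_control (shear v).
Proof.
elim: n v => [|n IHn] v p x; first by rewrite !shear_nil W_id comp1.
by rewrite shearS (copies_control_bypass (IHn _)) copies_control_shear1
  -(compA (W _)) -W_comp.
Qed.

Lemma shear_add n (v w : 'rV_n) p (x : H p n.+1) :
  shear (v + w)%R · x = shear v · shear w · x.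
Proof.
elim: n v w p x => [|n IHn] v w p x; first by rewrite !shear_nil.
rewrite !shearS hdD tlD shear1_add shear1_bypass;
  last exact: shear_copies_control.
rewrite -bypass_comp; congr (_ · _); apply: bypass_eq => *.
by rewrite IHn compA.
Qed.

Lemma shear_0 n p (x : H p n.+1) : shear (0%R : 'rV_n) · x = x.
Proof.
elim: n p x => [|n IHn] p x; first by rewrite shear_nil.
rewrite shearS hd0 tl0 shear1_0 (bypass_eq (g := pid C n.+1)) ?bypass_id //.
by move=> *; rewrite IHn comp1.
Qed.

Lemma shear_cons c n (v : 'rV_n) p (x : H p n.+2) :
  shear (consv c v) · x = bypass (shear v) · shear1 c n · x.
Proof. by rewrite shearS !hdtlE. Qed.

Lemma shear_cons0 n (v : 'rV_n) p (x : H p n.+2) :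
  shear (consv 0%R v) · x = bypass (shear v) · x.
Proof. by rewrite shear_cons shear1_0. Qed.

Lemma shear_consr c n p (x : H p n.+2) :
  shear (consv c (0%R : 'rV_n)) · x = shear1 c n · x.
Proof.
rewrite shear_cons (bypass_eq (g := pid C n.+1)) ?bypass_id //.
by move=> *; rewrite shear_0 comp1.
Qed.

Lemma s_shear c n (v : 'rV_n) p (x : H p n.+1) :
  s_ c n · shear (c *: v)%R · x = shear v · s_ c n · x.
Proof.
elim: n v p x => [|n IHn] v p x; first by rewrite !shear_nil.
rewrite !shearS hdZ tlZ -s_shear1 !bypassE -!swap_Ws swap_s.
by rewrite (W_square (IHn _)).
Qed.

Lemma shear_zeta n (v : 'rV_n) p (x : H p n) :
  shear v · zeta_ n · x = zeta_ n · x.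
Proof.
elim: n v p x => [|n IHn] v p x; first by rewrite shear_nil.
by rewrite shearS shear1_zeta !bypassE swap_zeta (W_fuse (IHn _)) swap_Wzeta.
Qed.

Lemma bypass_shear n (v : 'rV_n.+1) p (x : H p n.+3) :
  bypass (shear v) · x =
    bypass (bypass (shear (tl v))) · bypass (shear1 (hd v) n) · x.
Proof. by rewrite -bypass_comp. Qed.

Lemma shearSS n (v : 'rV_n.+2) p (x : H p n.+3) :
  shear v · x = bypass (bypass (shear (tl (tl v)))) ·
    bypass (shear1 (hd (tl v)) n) · shear1 (hd v) n.+1 · x.
Proof. by rewrite shearS bypass_shear. Qed.

(** * Sliding linear maps past shears *)

(** Diagrams made of linear generators, together with the linear map they
    denote. *)
Inductive lin : forall m n, H m n -> ('rV[k]_m -> 'rV[k]_n) -> Prop :=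
| lin_mu n : lin (mu_ n) (fun u => consv (hd u + hd (tl u))%R (tl (tl u)))
| lin_zeta n : lin (zeta_ n) (consv 0%R)
| lin_delta n : lin (delta_ n) (fun u => consv (hd u) u)
| lin_bang n : lin (bang_ n) (@tl n)
| lin_s c n : lin (s_ c n) (fun u => consv (c * hd u)%R (tl u))
| lin_swap n :
    lin (swap_ n) (fun u => consv (hd (tl u)) (consv (hd u) (tl (tl u))))
| lin_id n : lin (pid C n) id
| lin_W m n (f : H m n) l : lin f l ->
    lin (W f) (fun u => consv (hd u) (l (tl u)))
| lin_comp m n p (g : H n p) (f : H m n) lg lf : lin g lg -> lin f lf ->
    lin (g · f) (lg \o lf).

(** The key rule: f (y + x v) = f y + x f v.  As the rule is stable under
    composition and under W, only the generators remain to be checked. *)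
Lemma lin_shear_comm m n (f : H m n) l : lin f l ->
  forall v p (x : H p m.+1), W f · shear v · x = shear (l v) · W f · x.
Proof.
elim=> {m n f l}.
- move=> n v p x; rewrite shearSS mu_bypass shear1_mu2 shear1_mu shear_cons.
  by rewrite addrC shear1_add.
- by move=> n v p x; rewrite zeta_bypass shear_cons0.
- move=> n v p x; rewrite shearS delta_bypass shear1_delta shear_cons.
  by rewrite bypass_shear.
- by move=> n v p x; rewrite shearS bang_bypass bang_shear1.
- by move=> c n v p x; rewrite shearS s_bypass shear1_s shear_cons.
- move=> n v p x; rewrite shearSS swap_bypass swap_shear1 shear_cons
  bypass_shear.
  rewrite !hdtlE -(@shear1_bypass _ _ _ (shear1 _ _));
    last exact: copies_control_shear1.
  by rewrite bypass_shear1 WswapK.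
- by move=> n v p x; rewrite W_id !comp1.
- move=> m n f l _ IH v p x; rewrite shearS shear_cons.
  by rewrite !bypassE -swap_nat (W_square (IH _)) -swap_nat -shear1_nat.
- move=> m n q g f lg lf _ IHg _ IHf v p x.
  by rewrite W_comp !compA IHf IHg.
Qed.

Fixpoint zeros n : H 0 n := if n is n'.+1 then zeta_ n' · zeros n' else pid C 0.

Lemma lin_zeros m n (f : H m n) l : lin f l -> f · zeros m = zeros n.
Proof.
elim=> {m n f l} //=.
- by move=> n; rewrite mu_zeta.
- by move=> n; rewrite delta_zeta.
- by move=> n; rewrite bang_zeta.
- by move=> c n; rewrite s_zeta.
- by move=> n; rewrite swap_zeta -zeta_nat.
- by move=> n; rewrite comp1.
- by move=> m n f l _ IH; rewrite -zeta_nat IH.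
- by move=> m n p g f lg lf _ IHg _ IHf; rewrite compA IHf IHg.
Qed.

(** A shear is a linear diagram; this lets the key rule move shears past each
    other. *)
Lemma lin_shear n (w : 'rV_n) : exists2 l, lin (shear w) l &
  forall u, l u = consv (hd u) (tl u + hd u *: w)%R.
Proof.
elim: n w => [|n IHn] w.
  exists id; first exact: lin_id.
  move=> u; apply: row_eq; rewrite !hdtlE //; apply/rowP => -[] //.
have [l ll lE] := IHn (tl w); eexists.
  apply: lin_comp; last first.
    apply: lin_comp (lin_comp (lin_W (lin_s _ _)) (lin_delta _)).
    exact: lin_W (lin_mu _).
  apply: lin_comp (lin_swap _) (lin_comp (lin_W ll) (lin_swap _)).
move=> u /=; rewrite !hdtlE !lE !hdtlE; apply: row_eq; rewrite !hdtlE //.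
apply: row_eq; rewrite !hdtlE; last by [].
by rewrite addrC mulrC.
Qed.

(** * States *)

(** The relation {(x, x + c v) : c in k}. *)
Definition smear n (v : 'rV_n) : H n n := bang_ n · shear v · bangd_ n.

Lemma smearE n (v : 'rV_n) p (x : H p n) :
  smear v · x = bang_ n · shear v · bangd_ n · x.
Proof. by rewrite /smear !compA. Qed.

Lemma WsmearE n (v : 'rV_n) p (x : H p n.+1) :
  W (smear v) · x = W (bang_ n) · W (shear v) · W (bangd_ n) · x.
Proof. by rewrite /smear (W_comp (bang_ n)) (W_comp (shear v)) !compA. Qed.

Lemma lin_smear m n (f : H m n) l : lin f l ->
  forall v p (x : H p m), f · smear v · x = smear (l v) · f · x.
Proof.
by move=> fl v p x; rewrite !smearE bangd_nat -(lin_shear_comm fl) -bang_nat.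
Qed.

(** The sliding rule for the linear diagram [shear w] fixes the vector (0, v). *)
Lemma Wsmear_shear n (v w : 'rV_n) p (x : H p n.+1) :
  W (smear w) · shear v · x = shear v · W (smear w) · x.
Proof.
have [l ll lE] := lin_shear w.
rewrite !WsmearE bangd_bypass -shear_cons0 (lin_shear_comm ll).
by rewrite (lin_shear_comm (lin_bang n)) lE !hdtlE scale0r addr0.
Qed.

Lemma smear_comm n (v w : 'rV_n) p (x : H p n) :
  smear w · smear v · x = smear v · smear w · x.
Proof. by rewrite !(smearE v) -bang_nat Wsmear_shear -bangd_nat. Qed.

(** The state N is invariant under translation by every multiple of v, the
    multiple being an extra free output.  Keeping this output makes it immediate
    that these v form a subspace. *)
Definition absorbs n (N : H 0 n) (v : 'rV_n) :=
  shear v · bangd_ n · N = bangd_ n · N.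

Lemma absorbs_smear n N (v : 'rV_n) : absorbs N v -> smear v · N = N.
Proof. by rewrite smearE => ->; rewrite bang_bangd. Qed.

Lemma absorbs_add n N (v w : 'rV_n) :
  absorbs N v -> absorbs N w -> absorbs N (v + w)%R.
Proof. by rewrite /absorbs shear_add => ev ->. Qed.

Lemma absorbs_0 n N : @absorbs n N 0%R. Proof. by rewrite /absorbs shear_0. Qed.

Lemma absorbs_scale n N c (v : 'rV_n) : absorbs N v -> absorbs N (c *: v)%R.
Proof.
have [->|c0] := eqVneq c 0%R; first by rewrite scale0r => _; apply: absorbs_0.
by move=> iv; apply: (s_inj c0); rewrite s_shear s_bangd.
Qed.

Lemma absorbs_transl n N (v w : 'rV_n) : absorbs N v -> absorbs (smear w · N) v.
Proof. by rewrite /absorbs !bangd_nat => iv; rewrite -Wsmear_shear iv. Qed.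

Lemma shear1_bangd n p (x : H p n) :
  shear1 1%R n · bangd_ n.+1 · bangd_ n · x = bangd_ n.+1 · bangd_ n · x.
Proof.
have muW q (y : H q n.+1) : mu_ n · W (bangd_ n) · y = bangd_ n · bang_ n · y.
  by rewrite -swap_bangd mu_swap mu_bangd.
have -> : shear1 1%R n = W (mu_ n) · delta_ n.+1.
  rewrite /shear1; congr (_ · _); rewrite -[RHS]comp1 -W_id.
  by congr (W _ · _); apply: eq_tail => *; rewrite s_1 comp1.
by rewrite (compA (W _)) bangd_nat delta_nat (W_square muW) Wbang_delta.
Qed.

(** With t and u unconstrained, translating by u v and then by t v is the same
    as translating by u v alone, because (t, t + u) is unconstrained too.  The
    sliding rule applied to the vector (1, v) performs this substitution. *)
Lemma absorbs_self n N (v : 'rV_n) : absorbs (smear v · N) v.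
Proof.
have [l ll lE] := lin_shear v.
have key : W (shear v) · bangd_ n.+1 · bangd_ n · N =
    shear1 1%R n · shear (consv 0%R v) · W (shear v) · bangd_ n.+1 · bangd_ n
      · N.
  rewrite -{1}shear1_bangd -shear_consr (lin_shear_comm ll) lE !hdtlE.
  rewrite -!shear_consr -shear_add scale1r add0r.
  by congr (shear _ · _); apply: row_eq; rewrite !hdtlE ?addr0 ?add0r.
rewrite /absorbs smearE (bangd_nat (bang_ n)) bangd_nat.
have := lin_shear_comm (lin_bang n) (consv 0%R v); rewrite tl_cons => e.
by rewrite -e [in RHS]key bang_shear1.
Qed.

(** The normal form of a subspace of k^n given by generators. *)
Definition state n (A : seq 'rV_n) : H 0 n :=
  foldr (fun v x => smear v · x) (zeros n) A.
Local Open Scope ring_scope.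

Lemma absorbs_span n (A : seq 'rV_n) v : v \in <<A>>%VS -> absorbs (state A) v.
Proof.
move=> /(coord_span (X := in_tuple A)) ->.
apply: (big_ind (absorbs (state A))); [exact: absorbs_0 | exact: absorbs_add |].
move=> j _; apply: absorbs_scale.
have := mem_nth 0 (ltn_ord j); move: (A`_j) => w {j}.
elim: A => //= u A IH; rewrite inE => /orP[/eqP -> | wA];
  first exact: absorbs_self.
exact/absorbs_transl/IH.
Qed.

Lemma state_cat n (A B : seq 'rV_n) :
  state (A ++ B) = foldr (fun v x => smear v · x) (state B) A.
Proof. exact: foldr_cat. Qed.

Lemma state_catC n (A B : seq 'rV_n) : state (A ++ B) = state (B ++ A).
Proof.
elim: A => [|v A IH] /=; first by rewrite cats0.
rewrite -/(state _) IH; elim: B {IH} => //= w B IH.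
by rewrite smear_comm -/(state _) IH.
Qed.

Lemma state_absorb n (A B : seq 'rV_n) :
  {subset A <= <<B>>%VS} -> state (A ++ B) = state B.
Proof.
rewrite state_cat; elim: A => //= v A IH sAB; rewrite IH; last first.
  by move=> w wA; apply: sAB; rewrite inE wA orbT.
by apply/absorbs_smear/absorbs_span/sAB; rewrite inE eqxx.
Qed.

(** Both states equal the state of the concatenated list. *)
Lemma state_span n (A B : seq 'rV_n) : <<A>>%VS = <<B>>%VS -> state A = state B.
Proof.
move=> e; have sBA : {subset B <= <<A>>%VS} by move=> v /memv_span; rewrite e.
have sAB : {subset A <= <<B>>%VS} by move=> v /memv_span; rewrite e.
by rewrite -(state_absorb sBA) (state_catC B A) (state_absorb sAB).
Qed.

Lemma bangd_smear n p (x : H p n) :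
  bangd_ n · x = smear (consv 1%R (0%R : 'rV_n)) · zeta_ n · x.
Proof.
rewrite smearE shear_consr bangd_nat shear1_Wzeta.
by rewrite bang_nat s_1 bang_delta.
Qed.

(** If v has first coordinate c <> 0, then only the zero multiple of v added to
    (0, x) has first coordinate zero.  Here s_c is absorbed by ζ†, which uses
    that c is invertible. *)
Lemma zetad_smear_zeta n (v : 'rV_n.+1) p (x : H p n) : hd v != 0%R ->
  zetad_ n · smear v · zeta_ n · x = x.
Proof.
move=> v0; rewrite smearE -bang_nat shearS zetad_bypass bangd_nat shear1_Wzeta.
have e : zetad_ n · s_ (hd v) n = zetad_ n.
  by rewrite -[RHS]compf1; apply: eq_tail => *; rewrite compA zetad_s // compf1.
by rewrite -(compA (W (zetad_ n))) -W_comp e Wzetad_delta shear_zeta bang_zeta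
  zetad_bangd.
Qed.

Definition preserves_states m n (f : H m n) :=
  forall A, exists B, f · state A = state B.

Lemma lin_preserves m n (f : H m n) l : lin f l -> preserves_states f.
Proof.
move=> fl A; exists (map l A); elim: A => [|v A IH] /=.
  exact: lin_zeros fl.
by rewrite (lin_smear fl) -/(state _) IH.
Qed.

Lemma bangd_preserves n : preserves_states (bangd_ n).
Proof.
move=> A; have [B e] := lin_preserves (lin_zeta n) A.
by exists (consv 1%R 0%R :: B); rewrite bangd_smear e.
Qed.

Lemma state_zeta n (A : seq 'rV_n.+1) : all (fun v => hd v == 0%R) A ->
  state A = zeta_ n · state (map (@tl n) A).
Proof.
elim: A => //= v A IH /andP[/eqP v0 /IH e]; rewrite -/(state _) e.
by rewrite (lin_smear (lin_zeta n)) -{1}[v]cons_hdtl v0.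
Qed.

(** One step of Gaussian elimination: a generator v with nonzero first
    coordinate serves as pivot, and is dropped once the others are reduced. *)
Lemma zetad_preserves n : preserves_states (zetad_ n).
Proof.
move=> A; have [/state_zeta -> | /allPn[v vA v0]] := boolP
  (all (fun v => hd v == 0%R) A).
  by eexists; rewrite zetad_zeta.
pose B := [seq (w - (hd w / hd v) *: v)%R | w <- A].
have /state_zeta eB : all (fun v => hd v == 0%R) B.
  apply/allP => _ /mapP[w _ ->]; rewrite hdD -scaleNr hdZ mulNr.
  by rewrite divfK // subrr.
have -> : state A = state (v :: B).
  apply: state_span; apply/eqP; rewrite eqEsubv; apply/andP; split;
    apply/span_subvP.
    move=> w wA; rewrite -(subrK ((hd w / hd v) *: v) w)%R.
    rewrite memvD ?memvZ ?memv_span ?inE ?eqxx //.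
    by apply/orP; right; apply/mapP; exists w.
  move=> w; rewrite inE => /orP[/eqP -> | /mapP[u uA ->]];
    first exact: memv_span.
  by rewrite memvB ?memvZ ?memv_span.
by exists (map (@tl n) B); rewrite /= -/(state _) eB zetad_smear_zeta.
Qed.

(** * Every diagram without inputs is a state *)

(** The class of diagrams obtained from linear ones, ζ† and !† on the first
    wire.  ζ† and !† on other wires are reached through crossings. *)
Inductive generated : forall m n, H m n -> Prop :=
| generated_lin m n (f : H m n) l : lin f l -> generated f
| generated_bangd n : generated (bangd_ n)
| generated_zetad n : generated (zetad_ n)
| generated_comp m n p (g : H n p) (f : H m n) :
    generated g -> generated f -> generated (g · f).

Lemma generated_preserves m n (f : H m n) : generated f -> preserves_states f.
Proof.
elim=> {m n f} [m n f l /lin_preserves // | n | n |].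
- exact: bangd_preserves.
- exact: zetad_preserves.
move=> m n p g f _ gg _ gf A; have [B e] := gf A; have [B' e'] := gg B.
by exists B'; rewrite compA e.
Qed.

Lemma generated_W m n (f : H m n) : generated f -> generated (W f).
Proof.
elim=> {m n f}.
- by move=> m n f l fl; apply: generated_lin (lin_W fl).
- move=> n; have -> : W (bangd_ n) = swap_ n · bangd_ n.+1.
    by apply: eq_tail => *; rewrite compA swap_bangd.
  exact: generated_comp (generated_lin (lin_swap _)) (generated_bangd _).
- move=> n; have -> : W (zetad_ n) = zetad_ n.+1 · swap_ n.
    by apply: eq_tail => *; rewrite compA zetad_swap.
  exact: generated_comp (generated_zetad _) (generated_lin (lin_swap _)).
- by move=> m n p g f _ rg _ rf; rewrite W_comp; apply: generated_comp.
Qed.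

Lemma padr_padr a b (g : H a b) n q : padr (padr g n) q =
  hcast (addnA a n q) (addnA b n q) (padr g (n + q)).
Proof.
by rewrite /padr -(law_tensA L g (pid C n) (pid C q)) tens11.
Qed.

Lemma lin_padr m n (f : H m n) l :
  lin f l -> forall q, exists l', lin (padr f q) l'.
Proof.
elim=> {m n f l}.
- move=> n q; eexists; rewrite [padr _ q](padr_padr (i (sym_mu k)) n q).
  rewrite (hcast_id (m := (n + q).+2) (n := (n + q).+1)); exact: lin_mu.
- move=> n q; eexists; rewrite [padr _ q](padr_padr (i (sym_zeta k)) n q).
  rewrite (hcast_id (m := (n + q)) (n := (n + q).+1)); exact: lin_zeta.
- move=> n q; eexists; rewrite [padr _ q](padr_padr (i (sym_Delta k)) n q).
  rewrite (hcast_id (m := (n + q).+1) (n := (n + q).+2)); exact: lin_delta.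
- move=> n q; eexists; rewrite [padr _ q](padr_padr (i (sym_bang k)) n q).
  rewrite (hcast_id (m := (n + q).+1) (n := (n + q))); exact: lin_bang.
- move=> c n q; eexists; rewrite [padr _ q](padr_padr (i (sym_s c)) n q).
  rewrite (hcast_id (m := (n + q).+1) (n := (n + q).+1)); exact: lin_s.
- move=> n q; eexists; rewrite [padr _ q](padr_padr (pbraid C 1 1) n q).
  rewrite (hcast_id (m := (n + q).+2) (n := (n + q).+2)); exact: lin_swap.
- by move=> n q; eexists; rewrite padr_id; apply: lin_id.
- move=> m n f l _ IH q; have [l' fl'] := IH q.
  by eexists; rewrite padr_W; apply: lin_W fl'.
- move=> m n p g f lg lf _ IHg _ IHf q; have [l1 fl1] := IHg q.
  have [l2 fl2] := IHf q.
  by eexists; rewrite padr_comp; apply: lin_comp fl1 fl2.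
Qed.

Lemma generated_padr m n (f : H m n) q : generated f -> generated (padr f q).
Proof.
elim=> {m n f}.
- by move=> m n f l /lin_padr /(_ q)[l' fl']; apply: generated_lin fl'.
- move=> n; rewrite -padr_bangd [padr _ q](padr_padr (eval i (bang_dag k)) n q).
  rewrite (hcast_id (m := (n + q)) (n := (n + q).+1)) padr_bangd;
    exact: generated_bangd.
- move=> n; rewrite -padr_zetad [padr _ q](padr_padr (eval i (zeta_dag k)) n q).
  rewrite (hcast_id (m := (n + q).+1) (n := (n + q))) padr_zetad;
    exact: generated_zetad.
- by move=> m n p g f _ rg _ rf; rewrite padr_comp; apply: generated_comp.
Qed.

Lemma generated_tens m n m' n' (g : H m n) (f : H m' n') :
  generated g -> generated f -> generated (ptens g f).
Proof.
move=> rg rf; rewrite tens_padr; apply: generated_comp;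
  first exact: generated_padr.
elim: m {g rg} => [|m IH]; first by rewrite tens0f.
have := law_tensA L (pid C 1) (pid C m) f.
rewrite (hcast_id (m := m.+1 + m') (n := m.+1 + n')).
have -> : ptens (pid C 1) (pid C m) = pid C m.+1 by apply: (tens11 C 1 m).
by move=> <-; apply: generated_W.
Qed.

Lemma cap_generated n : generated (cap_ n).
Proof.
have -> : cap_ n = delta_ n · bangd_ n by apply: eq_tail => *;
  rewrite cap_bangd compA.
exact: generated_comp (generated_lin (lin_delta _)) (generated_bangd _).
Qed.

Lemma cup_generated n : generated (cup_ n).
Proof.
have n10 : (-1)%R != 0%R :> k by rewrite oppr_eq0 oner_eq0.
have -> : cup_ n = zetad_ n · mu_ n · s_ (-1)%R n.+1.
  apply: eq_tail => q x; rewrite (compA (zetad_ n)) (compA (mu_ n)) -cup_zetad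
    -s_mul mulrNN mulr1 s_1.
  by [].
apply: generated_comp (generated_zetad _) (generated_comp _ _).
  exact: generated_lin (lin_mu _).
exact: generated_lin (lin_s _ _).
Qed.

Lemma eval_generated m n (t : term (FR_symbol k) m n) : generated (eval i t).
Proof.
elim: t => {m n} /=.
- exact: generated_lin (lin_id 0).
- exact: generated_lin (lin_id 1).
- have := law_tensm0 L (pbraid C 1 1).
  rewrite (hcast_id (m := 2) (n := 2)) => <-; exact: generated_lin (lin_swap 0).
- move=> m n []; [move=> c|..].
  + have := law_tensm0 L (i (sym_s c)); rewrite (hcast_id (m := 1) (n := 1)).
    by move=> <-; apply: generated_lin (lin_s c 0).
  + have := law_tensm0 L (i (sym_mu k)); rewrite (hcast_id (m := 2) (n := 1)).
    by move=> <-; apply: generated_lin (lin_mu 0).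
  + have := law_tensm0 L (i (sym_zeta k)); rewrite (hcast_id (m := 0) (n := 1)).
    by move=> <-; apply: generated_lin (lin_zeta 0).
  + have := law_tensm0 L (i (sym_Delta k));
    rewrite (hcast_id (m := 1) (n := 2)).
    by move=> <-; apply: generated_lin (lin_delta 0).
  + have := law_tensm0 L (i (sym_bang k)); rewrite (hcast_id (m := 1) (n := 0)).
    by move=> <-; apply: generated_lin (lin_bang 0).
  + have := law_tensm0 L (i (sym_cup k)); rewrite (hcast_id (m := 2) (n := 0)).
    by move=> <-; apply: (cup_generated 0).
  + have := law_tensm0 L (i (sym_cap k)); rewrite (hcast_id (m := 0) (n := 2)).
    by move=> <-; apply: (cap_generated 0).
- by move=> m n p g rg f rf; apply: generated_comp.
- by move=> m n m' n' f rf g rg; apply: generated_tens.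
Qed.

Lemma eval_state n (t : term (FR_symbol k) 0 n) : exists A, eval i t = state A.
Proof.
have [A e] := generated_preserves (eval_generated t) [::].
by exists A; rewrite -e /= compf1.
Qed.

(** * Bending inputs into outputs *)

Definition bend m n (f : H m.+1 n) : H m n.+1 := W f · cap_ m.
Definition unbend m n (g : H m n.+1) : H m.+1 n := cup_ n · W g.
(** The zigzag equation straightens the wire bent down and up again. *)
Lemma bendK m n (f : H m.+1 n) : unbend (bend f) = f.
Proof.
rewrite /unbend /bend W_comp; apply: eq_tail => q x.
by rewrite !compA cup_nat zigzag.
Qed.

End Gens.

(** * PROP morphisms preserve states *)

Section Map.
Variables (k : fieldType) (C C' : PROP) (G : PROP_morphism C C').
Variable i : forall m n, FR_symbol k m n -> hom C m n.
Variable i' : forall m n, FR_symbol k m n -> hom C' m n.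
Hypothesis Gi : forall m n (g : FR_symbol k m n), pmap G (i g) = i' g.

Lemma pmap_padr a b (g : hom C a b) n : pmap G (padr g n) = padr (pmap G g) n.
Proof. by rewrite /padr pmap_tens pmap_id. Qed.
Lemma pmap_W a b (g : hom C a b) : pmap G (W g) = W (pmap G g).
Proof. by have := pmap_tens G (pid C 1) g; rewrite pmap_id. Qed.

Lemma pmap_swap n : pmap G (swap_ C n) = swap_ C' n.
Proof. by rewrite [LHS](pmap_padr (pbraid C 1 1) n) pmap_braid. Qed.
Lemma pmap_mu n : pmap G (mu_ i n) = mu_ i' n.
Proof. by rewrite [LHS](pmap_padr (i (sym_mu k)) n) Gi. Qed.
Lemma pmap_zeta n : pmap G (zeta_ i n) = zeta_ i' n.
Proof. by rewrite [LHS](pmap_padr (i (sym_zeta k)) n) Gi. Qed.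
Lemma pmap_delta n : pmap G (delta_ i n) = delta_ i' n.
Proof. by rewrite [LHS](pmap_padr (i (sym_Delta k)) n) Gi. Qed.
Lemma pmap_bang n : pmap G (bang_ i n) = bang_ i' n.
Proof. by rewrite [LHS](pmap_padr (i (sym_bang k)) n) Gi. Qed.
Lemma pmap_cup n : pmap G (cup_ i n) = cup_ i' n.
Proof. by rewrite [LHS](pmap_padr (i (sym_cup k)) n) Gi. Qed.
Lemma pmap_cap n : pmap G (cap_ i n) = cap_ i' n.
Proof. by rewrite [LHS](pmap_padr (i (sym_cap k)) n) Gi. Qed.
Lemma pmap_s c n : pmap G (s_ i c n) = s_ i' c n.
Proof. by rewrite [LHS](pmap_padr (i (sym_s c)) n) Gi. Qed.

Lemma pmap_bypass m n (f : hom C m.+1 n.+1) :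
  pmap G (bypass f) = bypass (pmap G f).
Proof. by rewrite /bypass !pmap_comp pmap_W !pmap_swap. Qed.

Lemma pmap_shear1 c n : pmap G (shear1 i c n) = shear1 i' c n.
Proof. by rewrite /shear1 !pmap_comp !pmap_W pmap_mu pmap_s pmap_delta. Qed.

Lemma pmap_shear n (v : 'rV_n) : pmap G (shear i v) = shear i' v.
Proof.
elim: n v => [|n IHn] v; first exact: pmap_id.
by have := pmap_comp G (bypass (shear i (tl v))) (shear1 i (hd v) n);
  rewrite pmap_bypass IHn pmap_shear1.
Qed.

Lemma pmap_smear n (v : 'rV_n) : pmap G (smear i v) = smear i' v.
Proof. by rewrite /smear /bangd_ !pmap_comp pmap_shear !pmap_bang pmap_cap. Qed.

Lemma pmap_state n (A : seq 'rV_n) : pmap G (state i A) = state i' A.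
Proof.
elim: A => [|v A IH]; last by rewrite [LHS]pmap_comp pmap_smear -/(state _ _)
  IH.
elim: n => [|n IHn]; first exact: pmap_id.
by rewrite [LHS]pmap_comp pmap_zeta; congr (_ · _).
Qed.

Lemma pmap_bend m n (f : hom C m.+1 n) :
  pmap G (bend i f) = bend i' (pmap G f).
Proof. by rewrite /bend pmap_comp pmap_W pmap_cap. Qed.
Lemma pmap_unbend m n (f : hom C m n.+1) :
  pmap G (unbend i f) = unbend i' (pmap G f).
Proof. by rewrite /unbend pmap_comp pmap_W pmap_cup. Qed.
Lemma pmap_eval m n (t : term (FR_symbol k) m n) :
  pmap G (eval i t) = eval i' t.
Proof.
elim: t => {m n} //=.
- exact: pmap_id.
- exact: pmap_id.
- exact: (pmap_braid G 1 1).
- by move=> m n p g <- f <-; rewrite pmap_comp.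
- by move=> m n m' n' f <- g <-; rewrite pmap_tens.
Qed.
End Map.

(** * Products of PROPs *)

Section Product.
Variables C D : PROP.

Lemma hcast_pair m m' n n' (em : m = m') (en : n = n')
  (f : hom C m n * hom D m n) :
  hcast (H := fun m n => (hom C m n * hom D m n)%type) em en f =
  (hcast em en f.1, hcast em en f.2).
Proof. by case: _ / em; case: _ / en; case: f. Qed.

Lemma prod_laws : PROP_laws
  (fun m n => @eq (hom C m n * hom D m n))
  (fun n => (pid C n, pid D n))
  (fun m n p g f => (g.1 · f.1, g.2 · f.2))
  (fun m n m' n' f g => (ptens f.1 g.1, ptens f.2 g.2))
  (fun m n => (pbraid C m n, pbraid D m n)).
Proof.
have LC := PROP_ax C; have LD := PROP_ax D.
split; intros; rewrite ?hcast_pair /=; try (move: f => [f1 f2] /=); congr pair;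
  rewrite ?hcast_pair /=.
all: try by [exact: (law_compA LC) | exact: (law_compA LD)].
all: try by [exact: (law_comp1m LC) | exact: (law_comp1m LD)].
all: try by [exact: (law_compm1 LC) | exact: (law_compm1 LD)].
all: try by [exact: (law_tens1 LC) | exact: (law_tens1 LD)].
all: try by [exact: (law_tens_comp LC) | exact: (law_tens_comp LD)].
all: try by [exact: (law_tensA LC) | exact: (law_tensA LD)].
all: try by [exact: (law_tens0m LC) | exact: (law_tens0m LD)].
all: try by [exact: (law_tensm0 LC) | exact: (law_tensm0 LD)].
all: try by [exact: (law_braid_nat LC) | exact: (law_braid_nat LD)].
all: try by [exact: (law_braidK LC) | exact: (law_braidK LD)].
all: try by [exact: (law_braidD LC) | exact: (law_braidD LD)].
all: try by [exact: (law_Dbraid LC) | exact: (law_Dbraid LD)].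
Qed.

Definition prod_PROP : PROP := MkPROP prod_laws.

Definition prod_fst : PROP_morphism prod_PROP C.
Proof. by exists (fun m n (f : hom prod_PROP m n) => f.1). Defined.
Definition prod_snd : PROP_morphism prod_PROP D.
Proof. by exists (fun m n (f : hom prod_PROP m n) => f.2). Defined.
End Product.

(** * Soundness of the equations in FinRel *)

Section FinRelStates.
Variable k : fieldType.
Local Notation F := (FinRel k).
Local Notation i := (@FR_interp k).
Local Open Scope ring_scope.

(** Vectors of k^n are represented by functions on nat, of which only the first
    n values matter: splitting a vector is then a shift of indices. *)
Definition row_of n (f : nat -> k) : 'rV[k]_n := \row_j f j.

Lemma row_ofP n (u : 'rV[k]_n) : exists f, u = row_of n f.
Proof.
exists (fun j => if insub j is Some j' then u 0 j' else 0).
by apply/rowP => j; rewrite !mxE valK.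
Qed.

Lemma row_of_eq n f g : reflect (forall j, (j < n)%N -> f j = g j)
  (row_of n f == row_of n g).
Proof.
apply: (iffP eqP) => [/rowP e j jn | e].
  by have := e (Ordinal jn); rewrite !mxE.
by apply/rowP => j; rewrite !mxE e.
Qed.

Lemma lsub_row_of m n f : lsubmx (row_of (m + n) f) = row_of m f.
Proof. by apply/rowP => j; rewrite !mxE. Qed.
Lemma rsub_row_of m n f :
  rsubmx (row_of (m + n) f) = row_of n (fun j => f (m + j)%N).
Proof. by apply/rowP => j; rewrite !mxE. Qed.

Definition related m n (L : hom F m n) (f g : nat -> k) : Prop :=
  (row_of m f, row_of n g) \in (L : linrel k m n).

Lemma relatedP m n (L L' : hom F m n) :
  (forall f g, related L f g <-> related L' f g) -> L = L'.
Proof.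
move=> e; apply: linrelP => u v.
have [f ->] := row_ofP u; have [g ->] := row_ofP v.
by apply/idP/idP => /e.
Qed.

Lemma related_comp m n p (L' : hom F n p) (L : hom F m n) f g :
  related (L' · L) f g <-> exists h, related L f h /\ related L' h g.
Proof.
split=> [/mem_linrel_comp[v] | [h hh]].
  by have [h ->] := row_ofP v; exists h.
by apply/mem_linrel_comp; exists (row_of n h).
Qed.

Lemma related_tens m n m' n' (L : hom F m n) (L' : hom F m' n') f g :
  related (ptens L L') f g <->
  related L f g /\ related L' (fun j => f (m + j)%N) (fun j => g (n + j)%N).
Proof.
rewrite /related mem_linrel_tens !lsub_row_of !rsub_row_of.
by split=> [/andP | [? ?]]; [|apply/andP].
Qed.

Lemma related_id n f g :
  related (pid F n) f g <-> forall j, (j < n)%N -> g j = f j.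
Proof.
by rewrite /related mem_linrel_id; split=> [/row_of_eq // | e]; apply/row_of_eq.
Qed.

Lemma row_of2 f : row_of 2 f =
  row_mx (row_of 1 f) (row_of 1 (fun j => f j.+1)) :> 'rV_(1 + 1).
Proof. by rewrite -[LHS](@hsubmxK _ 1 1 1) lsub_row_of rsub_row_of. Qed.

Lemma row1_eq (u v : 'rV[k]_1) : (u == v) = (u 0 0 == v 0 0).
Proof.
by apply/eqP/eqP => [-> // | e]; apply/rowP => j; rewrite !ord1.
Qed.

Lemma related_braid f g :
  related (pbraid F 1 1) f g <-> g 0%N = f 1%N /\ g 1%N = f 0%N.
Proof.
rewrite /related mem_linrel_braid (lsub_row_of 1 1) (rsub_row_of 1 1) row_of2.
split=> [/eqP/eq_row_mx[/eqP e1 /eqP e2] | [e1 e2]].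
  by move: e1 e2; rewrite !row1_eq !mxE => /eqP -> /eqP ->.
by apply/eqP; congr row_mx; apply/eqP; rewrite row1_eq !mxE ?e1 ?e2.
Qed.

Lemma related_s c f g : related (rel_s c) f g <-> g 0%N = c * f 0%N.
Proof. by rewrite /related mem_rel_s row1_eq !mxE; split=> /eqP. Qed.
Lemma related_mu f g : related (rel_mu k) f g <-> g 0%N = f 0%N + f 1%N.
Proof. by rewrite /related row_of2 mem_rel_mu row1_eq !mxE; split=> /eqP. Qed.
Lemma related_zeta f g : related (rel_zeta k) f g <-> g 0%N = 0.
Proof. by rewrite /related mem_rel_zeta row1_eq !mxE; split=> /eqP. Qed.
Lemma related_Delta f g :
  related (rel_Delta k) f g <-> g 0%N = f 0%N /\ g 1%N = f 0%N.
Proof.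
rewrite /related row_of2 mem_rel_Delta !row1_eq !mxE.
by split=> [/andP[/eqP ? /eqP ?] | [-> ->]]; rewrite ?eqxx.
Qed.
Lemma related_bang f g : related (rel_bang k) f g <-> True.
Proof. by rewrite /related mem_rel_bang. Qed.
Lemma related_cup f g : related (rel_cup k) f g <-> f 0%N = f 1%N.
Proof. by rewrite /related row_of2 mem_rel_cup row1_eq !mxE; split=> /eqP. Qed.
Lemma related_cap f g : related (rel_cap k) f g <-> g 0%N = g 1%N.
Proof. by rewrite /related row_of2 mem_rel_cap row1_eq !mxE; split=> /eqP. Qed.

(** The relation denoted by a term, as a formula about coordinates. *)
Fixpoint sem m n (t : term (FR_symbol k) m n) (f g : nat -> k) : Prop :=
  match t with
  | tid0 => True
  | tid1 => g 0%N = f 0%N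
  | tswap => g 0%N = f 1%N /\ g 1%N = f 0%N
  | tgen _ _ s => match s with
      | sym_s c => g 0%N = c * f 0%N
      | sym_mu => g 0%N = f 0%N + f 1%N
      | sym_zeta => g 0%N = 0
      | sym_Delta => g 0%N = f 0%N /\ g 1%N = f 0%N
      | sym_bang => True
      | sym_cup => f 0%N = f 1%N
      | sym_cap => g 0%N = g 1%N
      end
  | tcomp _ _ _ t' t => exists h, sem t f h /\ sem t' h g
  | ttens m n _ _ t t' =>
      sem t f g /\ sem t' (fun j => f (m + j)%N) (fun j => g (n + j)%N)
  end.

Lemma semP m n (t : term (FR_symbol k) m n) f g :
  related (eval i t) f g <-> sem t f g.
Proof.
elim: t f g => {m n} /=.
- by move=> f g; rewrite related_id.
- by move=> f g; rewrite related_id; split=> [-> // | e [|j]].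
- exact: related_braid.
- move=> m n []; [move=> c|..] => f g.
  + exact: related_s.
  + exact: related_mu.
  + exact: related_zeta.
  + exact: related_Delta.
  + exact: related_bang.
  + exact: related_cup.
  + exact: related_cap.
- move=> m n p t' IH' t IH f g; rewrite related_comp.
  by split=> -[h [h1 h2]]; exists h; split;
    [apply/IH|apply/IH'|apply/IH|apply/IH'].
- move=> m n m' n' t IH t' IH' f g; rewrite related_tens.
  by split=> -[h1 h2]; split; [apply/IH|apply/IH'|apply/IH|apply/IH'].
Qed.

End FinRelStates.

Section Sound.
Variable k : fieldType.
Local Open Scope ring_scope.

Ltac unpack := repeat match goal with
  | H : ex _ |- _ => destruct H
  | H : _ /\ _ |- _ => destruct H
  end.
Ltac start := split; rewrite /=; unfold addn; simpl; intros; unpack.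
(* The list l gives the values on the intermediate wires. *)
Ltac ex l := exists (nth 0 l).
(* Coordinates become variables, so that [subst] can eliminate them. *)
Ltac atoms := repeat match goal with
  | H : context [?x ?n] |- _ =>
      is_var x; let v := fresh "v" in set (v := x n) in *; clearbody v
  | |- context [?x ?n] =>
      is_var x; let v := fresh "v" in set (v := x n) in *; clearbody v
  end; subst.
Ltac fin := repeat split; simpl; atoms; try reflexivity; try ring.

Lemma sem_mu_dag f g : sem (mu_dag k) f g <-> f 0%N = g 0%N + g 1%N.
Proof.
start; first by fin.
ex ([:: g 0%N; g 1%N; g 1%N; g 0%N; f 0%N]); split.
  by split; first ex ([:: g 0%N; g 0%N]); fin.
by ex ([:: g 0%N; g 1%N; g 1%N + g 0%N; f 0%N]); fin.
Qed.

Lemma sem_Delta_dag f g :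
  sem (Delta_dag k) f g <-> g 0%N = f 0%N /\ g 0%N = f 1%N.
Proof.
start; first by fin.
ex ([:: f 0%N; f 1%N; g 0%N; g 0%N]); split; first fin.
ex ([:: f 0%N; f 1%N; g 0%N; g 0%N; g 0%N]); split; first fin.
by split; first ex ([:: f 0%N; g 0%N]); fin.
Qed.

Lemma sem_zeta_dag f g : sem (zeta_dag k) f g <-> f 0%N = 0.
Proof. by start; [fin | ex ([:: 0; f 0%N]); fin]. Qed.

Lemma sem_bang_dag f g : sem (bang_dag k) f g <-> True.
Proof. by start; [|ex ([:: g 0%N; g 0%N]); fin]. Qed.

Lemma sem_s_dag (c : k) f g : sem (s_dag c) f g <-> f 0%N = c * g 0%N.
Proof.
start; first by fin.
ex ([:: f 0%N; g 0%N; g 0%N]); split; first fin.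
by ex ([:: f 0%N; c * g 0%N; g 0%N]); fin.
Qed.

(* The abbreviations are from now on only used through the lemmas above. *)
Local Opaque mu_dag Delta_dag zeta_dag bang_dag s_dag.

Ltac dag := repeat match goal with
  | H : sem (mu_dag _) _ _ |- _ => apply (proj1 (sem_mu_dag _ _)) in H;
    simpl in H
  | H : sem (Delta_dag _) _ _ |- _ => apply (proj1 (sem_Delta_dag _ _)) in H;
    simpl in H
  | H : sem (zeta_dag _) _ _ |- _ => apply (proj1 (sem_zeta_dag _ _)) in H;
    simpl in H
  | H : sem (bang_dag _) _ _ |- _ => clear H
  | H : sem (s_dag _) _ _ |- _ => apply (proj1 (sem_s_dag _ _ _)) in H;
    simpl in H
  | |- sem (mu_dag _) _ _ => apply (proj2 (sem_mu_dag _ _)); simpl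
  | |- sem (Delta_dag _) _ _ => apply (proj2 (sem_Delta_dag _ _)); simpl
  | |- sem (zeta_dag _) _ _ => apply (proj2 (sem_zeta_dag _ _)); simpl
  | |- sem (bang_dag _) _ _ => apply (proj2 (sem_bang_dag _ _)); exact I
  | |- sem (s_dag _) _ _ => apply (proj2 (sem_s_dag _ _ _)); simpl
  end.
Ltac start_dag := split; rewrite /=; unfold addn; simpl; intros; unpack; dag;
  unpack.
Ltac fin_dag := repeat split; simpl; dag; repeat split; simpl; atoms;
  try exact I; try reflexivity; try assumption; try ring.

Lemma sem_sound m n t t' : @FR_equations k m n t t' ->
  forall f g, sem t f g <-> sem t' f g.
Proof.
case=> [ |  |  |  |  |  |  |  |  |  | b c | b c |  |  | c | c | c | c |  |  |
  |  |  |  |  |  |  |  |  |  | c cn0] f g.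
- by start_dag; [|ex ([:: 0; f 0%N])]; fin_dag.
- start_dag; first by ex ([:: f 0%N + f 1%N; f 2%N]); fin_dag.
  by ex ([:: f 0%N; f 1%N + f 2%N]); fin_dag.
- by start_dag; [|ex ([:: f 1%N; f 0%N])]; fin_dag.
- by start_dag; [|ex ([:: f 0%N; f 0%N])]; fin_dag.
- by start_dag; ex ([:: f 0%N; f 0%N]); fin_dag.
- by start_dag; [|ex ([:: f 0%N; f 0%N])]; fin_dag.
- start_dag; last by ex ([:: f 0%N + f 1%N]); fin_dag.
  ex ([:: f 0%N; f 0%N; f 1%N; f 1%N]); split; first by fin_dag.
  by ex ([:: f 0%N; f 1%N; f 0%N; f 1%N]); fin_dag.
- by start_dag; [|ex ([:: 0 : k])]; fin_dag.
- by start_dag; [|ex ([:: f 0%N + f 1%N])]; fin_dag.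
- by start_dag; [|ex ([:: 0 : k])]; fin_dag.
- by start_dag; [ex ([:: c * f 0%N])|]; fin_dag.
- start_dag; last by fin_dag.
  ex ([:: f 0%N; f 0%N]); split; first by fin_dag.
  by ex ([:: b * f 0%N; c * f 0%N]); fin_dag.
- by start_dag; fin_dag.
- by start_dag; [ex ([:: 0 : k])|]; fin_dag.
- start_dag; first by ex ([:: f 0%N + f 1%N]); fin_dag.
  by ex ([:: c * f 0%N; c * f 1%N]); fin_dag.
- by start_dag; [|ex ([:: 0 : k])]; fin_dag.
- start_dag; first by ex ([:: c * f 0%N]); fin_dag.
  by ex ([:: f 0%N; f 0%N]); fin_dag.
- by start_dag; [|ex ([:: c * f 0%N])]; fin_dag.
- by start_dag; [|ex ([:: f 0%N; f 0%N; f 0%N])]; fin_dag.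
- by start_dag; [ex ([:: f 0%N; f 0%N; f 0%N])|]; fin_dag.
- start_dag; first by ex ([:: f 0%N + f 1%N]); fin_dag.
  (* the wire between the two additions carries g 0 - f 0 *)
  have e : f 0%N + f 1%N = g 0%N + g 1%N by fin_dag.
  have {}e : f 1%N = g 0%N + g 1%N - f 0%N by rewrite -e; ring.
  by ex ([:: f 0%N; g 0%N - f 0%N; g 1%N]); fin_dag.
- start_dag; last by ex ([:: f 0%N + f 1%N]); fin_dag.
  have e : f 0%N + f 1%N = g 0%N + g 1%N by fin_dag.
  have {}e : f 0%N = g 0%N + g 1%N - f 1%N by rewrite -e; ring.
  by ex ([:: g 0%N; g 1%N - f 1%N; f 1%N]); fin_dag.
- by start_dag; [ex ([:: f 0%N])|ex ([:: f 0%N; f 1%N; f 1%N])]; fin_dag.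
- by start_dag; [ex ([:: f 0%N; f 0%N; f 1%N])|ex ([:: f 0%N])]; fin_dag.
- by start_dag; [|ex ([:: f 0%N; 0])]; fin_dag.
- by start_dag; [|ex ([:: 0 : k])]; fin_dag.
- by start_dag; [|ex ([:: f 0%N; f 0%N])]; fin_dag.
- by start_dag; [|ex ([:: 0 : k])]; fin_dag.
- start_dag; first by ex ([:: f 0%N + f 1%N]); fin_dag.
  have e : f 0%N + f 1%N = 0 by fin_dag.
  have {}e : f 1%N = - f 0%N by apply: (addrI (f 0%N)); rewrite e subrr.
  by ex ([:: - f 0%N; - f 0%N]); fin_dag.
- by start_dag; [ex ([:: g 0%N])|]; fin_dag.
- start_dag.
    have -> : f 0%N = c * g 0%N by fin_dag.
    by rewrite mulKf.
  by fin_dag; rewrite mulVKf.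
Qed.
End Sound.

(** * States in FinRel are spans *)

Section Span.
Variable k : fieldType.
Local Notation F := (FinRel k).
Local Notation i := (@FR_interp k).
Local Open Scope ring_scope.

Lemma FR_sound m n t t' : @FR_equations k m n t t' -> eval i t = eval i t'.
Proof.
by move=> e; apply: relatedP => f g; rewrite !semP; apply: sem_sound.
Qed.

Definition graph m n (L : hom F m n) (l : 'rV[k]_m -> 'rV[k]_n) :=
  forall u v, ((u, v) \in (L : linrel k m n)) = (v == l u).

Lemma graph_relatedP m n (L : hom F m n) l :
  (forall f g, related L f g <-> row_of n g = l (row_of m f)) -> graph L l.
Proof.
move=> e u v; have [f ->] := row_ofP u; have [g ->] := row_ofP v.
by apply/idP/eqP => /e.
Qed.

Lemma hd_row n (f : nat -> k) : hd (row_of n.+1 f) = f 0%N.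
Proof. by rewrite /hd mxE. Qed.
Lemma tl_row n (f : nat -> k) : tl (row_of n.+1 f) = row_of n (fun j => f j.+1).
Proof. exact: (rsub_row_of 1 n). Qed.

Lemma row_of_S n (f : nat -> k) c (w : 'rV_n) :
  row_of n.+1 f = consv c w <-> f 0%N = c /\ row_of n (fun j => f j.+1) = w.
Proof.
rewrite -(hd_row n) -tl_row; split=> [-> | [<- <-]];
  first by rewrite hd_cons tl_cons.
by rewrite cons_hdtl.
Qed.

Lemma related_padr a b n (L : hom F a b) f g : related (padr L n) f g <->
  related L f g /\ row_of n (fun j => g (b + j)%N) =
    row_of n (fun j => f (a + j)%N).
Proof.
rewrite related_tens related_id.
by split=> -[h e]; split=> //; [apply/eqP/row_of_eq | apply/row_of_eq/eqP].
Qed.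

Lemma lin_graph m n (L : hom F m n) l : lin i L l -> graph L l.
Proof.
elim=> {m n L l}.
- move=> n; apply: graph_relatedP => f g.
  by apply: (iff_trans (@related_padr 2 1 n (rel_mu k) f g));
    rewrite related_mu row_of_S !tl_row !hd_row.
- move=> n; apply: graph_relatedP => f g.
  by apply: (iff_trans (@related_padr 0 1 n (rel_zeta k) f g));
    rewrite related_zeta row_of_S.
- move=> n; apply: graph_relatedP => f g.
  apply: (iff_trans (@related_padr 1 2 n (rel_Delta k) f g));
    rewrite related_Delta row_of_S hd_row.
  by rewrite -[row_of n.+1 f]cons_hdtl row_of_S hd_row tl_row; tauto.
- move=> n; apply: graph_relatedP => f g.
  by apply: (iff_trans (@related_padr 1 0 n (rel_bang k) f g));
    rewrite related_bang tl_row; tauto.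
- move=> c n; apply: graph_relatedP => f g.
  by apply: (iff_trans (@related_padr 1 1 n (rel_s c) f g));
    rewrite related_s row_of_S hd_row tl_row.
- move=> n; apply: graph_relatedP => f g.
  by apply: (iff_trans (@related_padr 2 2 n (pbraid F 1 1) f g));
    rewrite related_braid !row_of_S !tl_row !hd_row; tauto.
- by move=> n u v; rewrite mem_linrel_id.
- move=> m n L l _ IH; apply: graph_relatedP => f g.
  apply: (iff_trans (@related_tens k 1 1 m n (pid F 1) L f g)).
  rewrite related_id row_of_S hd_row tl_row /related IH.
  by split=> [[e /eqP e'] | [e e']]; split; rewrite ?e' //; [exact: e | case].
- move=> m n p L' L l' l _ IH' _ IH u v.
  apply/mem_linrel_comp/eqP => [[w] | ->]; last first.
    by exists (l u); rewrite IH IH' !eqxx.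
  by rewrite IH IH' => -[/eqP -> /eqP].
Qed.

Lemma mem_bangd n u w :
  ((u, w) \in (bangd_ i n : linrel k n n.+1)) = (tl w == u).
Proof.
have gb := lin_graph (lin_bang i n.+1).
apply/mem_linrel_comp/eqP => [[h] | <-].
  have [f ->] := row_ofP u; have [g ->] := row_ofP h.
  rewrite gb => -[/(@related_padr 0 2 n (rel_cap k))[_ e] /eqP ->].
  by rewrite !tl_row.
exists (consv (hd w) w); rewrite gb tl_cons eqxx; split=> //.
have [f ->] := row_ofP w.
rewrite tl_row.
have -> : consv (hd (row_of n.+1 f)) (row_of n.+1 f) =
    row_of n.+2 (fun j => f j.-1).
  by apply/esym/row_of_S; rewrite hd_row.
by apply/(@related_padr 0 2 n (rel_cap k)); split=> //; apply/related_cap.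
Qed.

Lemma shear_graph n (v : 'rV_n) :
  graph (shear i v) (fun u => consv (hd u) (tl u + hd u *: v)).
Proof.
by have [l /lin_graph gp lE] := lin_shear i v; move=> u w; rewrite gp lE.
Qed.

Lemma mem_smear n (v : 'rV_n) u w :
  reflect (exists c, w = u + c *: v) ((u, w) \in (smear i v : linrel k n n)).
Proof.
have gp := shear_graph v; have gb := lin_graph (lin_bang i n).
apply: (iffP (mem_linrel_comp _ _ _ _)) => [[x [+]] | [c ->]].
  move=> /mem_linrel_comp[y []]; rewrite mem_bangd gp gb => /eqP <-.
  by move=> /eqP -> /eqP ->; rewrite tl_cons; exists (hd y).
exists (consv c (u + c *: v)); rewrite gb tl_cons eqxx; split=> //.
apply/mem_linrel_comp; exists (consv c u); rewrite mem_bangd gp tl_cons hd_cons.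
by rewrite !eqxx.
Qed.

Lemma mem_state n (A : seq 'rV_n) u w :
  ((u, w) \in (state i A : linrel k 0 n)) = (w \in <<A>>%VS).
Proof.
elim: A w => [|v A IH] w.
  rewrite span_nil memv0; elim: n w => [|n IHn] w.
    by rewrite [w]thinmx0 eqxx [u]thinmx0; apply: mem0v.
  apply/mem_linrel_comp/eqP => [[x []] | ->].
    rewrite IHn (lin_graph (lin_zeta i n)) => /eqP -> /eqP ->.
    by apply: row_eq; rewrite ?hd_cons ?tl_cons ?hd0 ?tl0.
  exists 0; rewrite IHn (lin_graph (lin_zeta i n)) eqxx; split=> //.
  by apply/eqP/row_eq; rewrite ?hd_cons ?tl_cons ?hd0 ?tl0.
rewrite span_cons; apply/mem_linrel_comp/memv_addP
  => [[x []] | [x xv [y yA ->]]].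
  rewrite IH => xA /mem_smear[c ->]; exists (c *: v);
    first by rewrite memvZ ?memv_line.
  by exists x => //; rewrite addrC.
exists y; rewrite IH; split=> //; apply/mem_smear.
by have /vlineP[c ->] := xv; exists c; rewrite addrC.
Qed.

Lemma state_full n (L : hom F 0 n) : exists A, L = state i A.
Proof.
pose p := linfun (fun t : 'rV[k]_0 * 'rV[k]_n => t.2).
have lp : linear (fun t : 'rV[k]_0 * 'rV[k]_n => t.2) by [].
exists (vbasis (p @: (L : linrel k 0 n))%VS : seq _).
apply: linrelP => u w; rewrite mem_state (span_basis (vbasisP _)).
apply/idP/memv_imgP => [uw | [[u' w'] Lw]]; first by exists (u, w);
  rewrite ?linfun_linear.
rewrite linfun_linear //= => ->.
by have -> : u = u' by rewrite [u]thinmx0 [u']thinmx0.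
Qed.

End Span.

(** * Fullness, completeness and the universal property *)

Section Main.
Variable k : fieldType.
Local Notation F := (FinRel k).
Local Notation j := (@FR_interp k).
Local Notation Free := (free_PROP (FR_symbol k)).
Local Notation gen :=
  (fun m n (g : FR_symbol k m n) => tclass (tgen g) : hom Free m n).
Local Notation q := (free_lift j).

Lemma q_gen m n g : pmap q (@gen m n g) = FR_interp g.
Proof. exact: free_lift_gen. Qed.

Lemma unbendK m n (f : hom F m.+1 n) : unbend j (bend j f) = f.
Proof. exact: (bendK (@FR_sound k)). Qed.

Lemma q_full m n (L : hom F m n) : exists f, pmap q f = L.
Proof.
elim: m n L => [|m IH] n L.
  have [A ->] := state_full L; exists (state gen A); exact: (pmap_state q_gen).
have [f e] := IH n.+1 (bend j L).
by exists (unbend gen f); rewrite (pmap_unbend q_gen) e unbendK.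
Qed.

Section Target.
Variables (D : PROP) (h : PROP_morphism Free D).
Hypothesis Eh : morph_eq (morph_comp h (lhs_morphism (FR_equations k)))
  (morph_comp h (rhs_morphism (FR_equations k))).
Local Notation d := (fun m n (g : FR_symbol k m n) => pmap h (gen m n g)).

Lemma h_eval m n (t : term (FR_symbol k) m n) : pmap h (tclass t) = eval d t.
Proof.
rewrite -(free_lift_class d t).
by apply: free_lift_unique => *; rewrite free_lift_gen.
Qed.

Lemma D_sound m n t t' : @FR_equations k m n t t' -> eval d t = eval d t'.
Proof.
move=> e; rewrite -!h_eval.
pose E (e : term _ m n * term _ m n) := FR_equations k m n e.1 e.2.
have := Eh (tclass (tgen (exist E (t, t') e))).
by rewrite /= !eval_trepr.
Qed.

(** The normal forms of t and t' are computed in the product of D and FinRel,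
    which gives one list of vectors for both interpretations. *)
Lemma state_complete n (t t' : term (FR_symbol k) 0 n) :
  eval j t = eval j t' -> eval d t = eval d t'.
Proof.
pose p m n (g : FR_symbol k m n) : hom (prod_PROP D F) m n :=
  (d m n g, FR_interp g).
have p1 m r g : pmap (prod_fst D F) (p m r g) = d m r g by [].
have p2 m r g : pmap (prod_snd D F) (p m r g) = FR_interp g by [].
have Ep m r s s' : @FR_equations k m r s s' -> eval p s = eval p s'.
  move=> e; rewrite [LHS]surjective_pairing [RHS]surjective_pairing.
  have e1 u : (eval p u).1 = eval d u := pmap_eval p1 u.
  have e2 u : (eval p u).2 = eval j u := pmap_eval p2 u.
  by rewrite !e1 !e2 (D_sound e) (FR_sound e).
have [A eA] := eval_state Ep t; have [A' eA'] := eval_state Ep t'.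
rewrite -(pmap_eval p1) -(pmap_eval p1) -(pmap_eval p2) -(pmap_eval p2).
rewrite eA eA' !(pmap_state p1) !(pmap_state p2) => eN;
  apply: (state_span D_sound).
by apply/vspaceP => w; rewrite -!(mem_state _ 0) eN.
Qed.

Lemma complete m n (f f' : hom Free m n) :
  pmap q f = pmap q f' -> pmap h f = pmap h f'.
Proof.
elim: m n f f' => [|m IH] n f f' e.
  rewrite -(treprK f) -(treprK f') !h_eval; apply: state_complete.
  exact: e.
rewrite -[LHS](bendK D_sound) -[RHS](bendK D_sound); congr unbend.
have dE m' n' g : pmap h (gen m' n' g) = d m' n' g by [].
rewrite -!(pmap_bend dE); apply: IH.
by rewrite !(pmap_bend q_gen) e.
Qed.

(** The value in D of some diagram denoting L; by [complete] the choice of the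
    diagram does not matter. *)
Definition descend m n (L : hom F m n) : hom D m n :=
  pmap h (projT1 (cid (q_full L))).

Lemma descendE m n (f : hom Free m n) : descend (pmap q f) = pmap h f.
Proof. by apply: complete; case: cid. Qed.

Definition descend_morphism : PROP_morphism F D.
Proof.
exists descend.
- by move=> n; rewrite -(pmap_id q) descendE pmap_id.
- move=> m n p g f; have [g' <-] := q_full g; have [f' <-] := q_full f.
  by rewrite -pmap_comp !descendE pmap_comp.
- move=> m n m' n' f g; have [g' <-] := q_full g; have [f' <-] := q_full f.
  by rewrite -pmap_tens !descendE pmap_tens.
- by move=> m n; rewrite -(pmap_braid q) descendE pmap_braid.
Defined.
End Target.
End Main.

Theorem mainTheorem2 (k : fieldType) :
  is_coequalizer
    (lhs_morphism (FR_equations k)) (rhs_morphism (FR_equations k))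
    (free_lift (@FR_interp k)).
Proof.
split.
  apply: free_lift_unique => m n [[t t'] /= e].
  by rewrite !eval_trepr (FR_sound e).
move=> D h Eh; exists (descend_morphism Eh); split.
  by move=> m n f; apply: descendE.
move=> u' eu m n L; have [f <-] := q_full L.
exact: etrans (eu _ _ f) (esym (descendE Eh f)).
Qed.
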